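(* Let $\{\varepsilon_i : i \in \mathbb{Z}\}$ be independent and identically distributed real random variables with $\mathbb{E}\varepsilon_i = 0$ and finite variance, having a common bounded probability density $f_\varepsilon$. Let $\{a_i\}_{i\ge 0}$ be real coefficients with $\sum_{i=0}^\infty |a_i| < \infty$ and $\sum_{i=0}^\infty a_i \neq 0$, and let $X_n = \sum_{i=0}^\infty a_i \varepsilon_{n-i}$, $n \in \mathbb{N}$, with common marginal density $f$. Assume $S(f) = -\int_{\mathbb{R}} f(x)\log f(x)\,dx$ is finite. Let $K$ be a kernel with $\int K = 1$, $\{h_n\}$ positive bandwidths, and $f_n(x) = \frac{1}{nh_n}\sum_{i=1}^n K\big(\frac{x-X_i}{h_n}\big)$. Assume: $h_n \asymp (n^{-1}\log n)^{1/5}$; $K$ is bounded, has bounded support and is Hölder continuous of some order $\iota\in(0,1]$; $\int uK(u)\,du = 0$; $f_\varepsilon, f_\varepsilon', f_\varepsilon''$ are bounded and belong to $\mathcal{L}^2(\mathbb{R})$; $f''$ is bounded. Let $\{\gamma_n\}$ be positive reals with $\gamma_n\to 0$ and $h_n = o(\gamma_n)$, let $A_n = \{x : 0<\gamma_n \le f_n(x)\}$ and $S_n(f) = -\int_{A_n} f_n(x)\log f_n(x)\,dx$. Then $$\limsup_{n\to\infty} \Big(\frac{n\gamma_n^5}{\log n}\Big)^{2/5}\,\Big\| S_n(f) - \int_{A_n} \big(-\log f(x)\big) f(x)\,dx\Big\|_2 < \infty,$$ where $\|Y\|_2 = (\mathbb{E} Y^2)^{1/2}$.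
   Context: $a_n \asymp b_n$ means $0<\liminf a_n/b_n \le \limsup a_n/b_n<\infty$. *)

(* Defs.v *)
From HB Require Import structures.
From mathcomp Require Import all_boot all_order all_algebra.
From mathcomp Require Import all_classical all_reals all_analysis.
Set Implicit Arguments. Unset Strict Implicit. Unset Printing Implicit Defensive.
Import Order.TTheory GRing.Theory Num.Theory.
Import numFieldNormedType.Exports.
Local Open Scope classical_set_scope.
Local Open Scope ring_scope.

Definition mutual_indep {d} {T : measurableType d} {R : realType}
  (P : probability T R) (I : eqType) (X : I -> T -> R) : Prop :=
  forall (J : seq I) (B : I -> set R), uniq J ->
    (forall i, i \in J -> measurable (B i)) ->
    P (\bigcap_(i in [set i | i \in J]) (X i @^-1` B i)) =
    (\prod_(i <- J) P (X i @^-1` B i))%E.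

Definition has_density {d} {T : measurableType d} {R : realType}
  (P : probability T R) (X : T -> R) (g : R -> R) : Prop :=
  [/\ (forall x, 0 <= g x), measurable_fun setT g &
    forall B, measurable B ->
      P (X @^-1` B) = (\int[lebesgue_measure]_(x in B) (g x)%:E)%E].

Definition asymp {R : realType} (a b : nat -> R) : Prop :=
  (0 < limn_einf (fun n => (a n / b n)%:E))%E /\
  (limn_esup (fun n => (a n / b n)%:E) < +oo)%E.

Definition kde {d} {T : measurableType d} {R : realType}
  (K : R -> R) (h : nat -> R) (X : nat -> T -> R) (n : nat) (t : T) (x : R) : R :=
  (n%:R * h n)^-1 * \sum_(1 <= i < n.+1) K ((x - X i t) / h n).

Definition Aset {d} {T : measurableType d} {R : realType}
  (K : R -> R) (h gam : nat -> R) (X : nat -> T -> R) (n : nat) (t : T) : set R :=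
  [set x | 0 < gam n <= kde K h X n t x].

Definition entropy_est {d} {T : measurableType d} {R : realType}
  (K : R -> R) (h gam : nat -> R) (X : nat -> T -> R) (n : nat) (t : T) : R :=
  - Rintegral lebesgue_measure (Aset K h gam X n t)
      (fun x => kde K h X n t x * ln (kde K h X n t x)).

Definition entropy_target {d} {T : measurableType d} {R : realType}
  (K : R -> R) (h gam : nat -> R) (X : nat -> T -> R) (f : R -> R) (n : nat) (t : T) : R :=
  Rintegral lebesgue_measure (Aset K h gam X n t) (fun x => - ln (f x) * f x).

Definition L2norm {d} {T : measurableType d} {R : realType}
  (P : probability T R) (Y : T -> R) : \bar R :=
  Lnorm P 2%:E (EFin \o Y).

(* Main.v *)
From HB Require Import structures.
From mathcomp Require Import all_boot all_order all_algebra.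
From mathcomp Require Import all_classical all_reals all_analysis.
From mathcomp Require Import measurable_realfun.
From mathcomp Require Import ring lra.
Require Import Defs.
Set Implicit Arguments. Unset Strict Implicit. Unset Printing Implicit Defensive.
Import Order.TTheory GRing.Theory Num.Theory.
Import numFieldNormedType.Exports.
Local Open Scope classical_set_scope.
Local Open Scope ring_scope.

(** On [A_n] the estimation error is controlled pointwise through [x ln x]. Where [f_n] is
    at most a constant level [M], [x ln x] has slope at most [1 + |ln gam_n| + |ln M|], so
    the error is bounded by [|f_n - E f_n| + |E f_n - f|], integrated over a set of
    measure at most [int |K| / gam_n]. Where [f_n > M], the error is bounded both by
    [2 f_n ln(M + C / h_n)] and by [8 (f_n - E f_n)^2], and the product of these two
    bounds suffices for the squared error. Since the bias is [O(h_n^2)], everything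
    reduces to the integrated variance [E int (f_n - E f_n)^2 = O(1 / (n h_n))].

    The integrated variance is a double sum of covariances
    [E G(X_i - X_j) - E G(X_i - X_j')], with [G] the autocorrelation of the scaled kernel
    and [X_j'] an independent copy of [X_j]. Averaging [G] over the most recent innovation
    of [X_i] with nonzero coefficient gives a function whose second-order differences are
    bounded uniformly in [h_n], because they fall on the density of the innovation.
    Replacing the remaining shared innovations by independent copies one at a time then
    costs [O(sum_l |a_l a_(l+i-j)|)], and these costs are summable because the coefficients
    are. *)

(** Put [rho = (ln n / n)^(1/5)], which is of the order of [h_n]. The normalising factor is then
    [(gam_n / rho)^2], so the mean squared error has to be [O((rho / gam_n)^4)]. As
    [rho^5 n = ln n], the variance [1 / (n h_n)] is of order [rho^4 / ln n]. Multiplied by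
    [(gam_n / rho)^4], the three contributions become [gam_n^3 L^2 / ln n] for the deviation,
    [gam_n^4 ln(M + C / h_n) / ln n] for the large values and [gam_n^2 L^2] for the bias, with
    [L = 1 + |ln gam_n| + |ln M|]. They stay bounded because [gam_n L] does and because
    [1 / h_n = O(n)]. The only pointwise control of [f_n] is the crude [C / h_n], hence the separate
    treatment of large values. Averaging over an innovation that is not shared is possible because,
    with [m0] the least index of a nonzero coefficient, the innovation of index [i - m0] is later
    than all those entering [X_j] when [j < i]. *)

Section integration_tools.
Context {R : realType}.

(** * Integration against probabilities and densities *)

Lemma bounded_integrable d (T : measurableType d) (P : probability T R)
    (g : T -> R) (B : R) :
  measurable_fun setT g -> (forall x, `|g x| <= B) ->
  P.-integrable setT (EFin \o g).
Proof.
move=> mg gB; apply: (@le_integrable _ _ _ _ _ measurableT _ (EFin \o cst B)).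
- exact/measurable_EFinP.
- by move=> x _ /=; rewrite lee_fin (le_trans (gB x))// ler_norm.
- exact: finite_measure_integrable_cst.
Qed.

Lemma integrable_funD d (T : measurableType d) (mu : {measure set T -> \bar R})
    (D : set T) (f g : T -> R) : measurable D ->
  mu.-integrable D (EFin \o f) -> mu.-integrable D (EFin \o g) ->
  mu.-integrable D (EFin \o (fun x => f x + g x)).
Proof. by move=> mD fi gi; exact: (integrableD mD fi gi). Qed.

Lemma integrable_funB d (T : measurableType d) (mu : {measure set T -> \bar R})
    (D : set T) (f g : T -> R) : measurable D ->
  mu.-integrable D (EFin \o f) -> mu.-integrable D (EFin \o g) ->
  mu.-integrable D (EFin \o (fun x => f x - g x)).
Proof. by move=> mD fi gi; exact: (integrableB mD fi gi). Qed.

Lemma integrable_funZ d (T : measurableType d) (mu : {measure set T -> \bar R})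
    (D : set T) (c : R) (f : T -> R) : measurable D ->
  mu.-integrable D (EFin \o f) ->
  mu.-integrable D (EFin \o (fun x => c * f x)).
Proof. by move=> mD fi; exact: (integrableZl mD c fi). Qed.

Lemma integrable_fun_sum d (T : measurableType d) (mu : {measure set T -> \bar R})
    (D : set T) (I : Type) (s : seq I) (f : I -> T -> R) : measurable D ->
  (forall i, mu.-integrable D (EFin \o f i)) ->
  mu.-integrable D (EFin \o (fun x => \sum_(i <- s) f i x)).
Proof.
move=> mD fi; elim: s => [|i s IH].
  rewrite (_ : (fun x => _) = cst 0); last by apply/funext => x; rewrite big_nil.
  exact: integrable0.
rewrite (_ : (fun x => _) = (fun x => f i x + \sum_(j <- s) f j x)); last first.
  by apply/funext => x; rewrite big_cons.
exact: integrable_funD.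
Qed.

Lemma Rintegral_sum d (T : measurableType d) (mu : {measure set T -> \bar R})
    (D : set T) (I : Type) (s : seq I) (f : I -> T -> R) : measurable D ->
  (forall i, mu.-integrable D (EFin \o f i)) ->
  \int[mu]_(x in D) (\sum_(i <- s) f i x) = \sum_(i <- s) \int[mu]_(x in D) f i x.
Proof.
move=> mD fi; elim: s => [|i s IH].
  rewrite big_nil; under eq_Rintegral do rewrite big_nil.
  by rewrite /Rintegral integral0.
rewrite big_cons; under eq_Rintegral do rewrite big_cons.
by rewrite RintegralD// ?IH//; exact: integrable_fun_sum.
Qed.

Lemma normr_Rintegral_dominated d (T : measurableType d)
    (mu : {measure set T -> \bar R}) (D : set T) (f G : T -> R) : measurable D ->
  mu.-integrable D (EFin \o f) -> mu.-integrable D (EFin \o G) ->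
  (forall x, D x -> `|f x| <= G x) ->
  `|\int[mu]_(x in D) f x| <= \int[mu]_(x in D) G x.
Proof.
move=> mD fi Gi fG; apply: (le_trans (le_normr_Rintegral mD fi)).
by apply: le_Rintegral => //; exact: (integrable_norm fi).
Qed.

Lemma integrableM_bounded d (T : measurableType d)
    (mu : {measure set T -> \bar R}) (rho k : T -> R) (B : R) :
  mu.-integrable setT (EFin \o rho) -> measurable_fun setT k ->
  (forall x, `|k x| <= B) ->
  mu.-integrable setT (fun x => (rho x * k x)%:E).
Proof.
move=> irho mk kB.
have mrho : measurable_fun setT rho by exact/measurable_EFinP/(measurable_int mu).
apply: (@le_integrable _ _ _ _ _ measurableT _ (fun x => B%:E * (EFin \o rho) x)%E).
- by apply/measurable_EFinP; exact: measurable_funM.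
- move=> x _ /=; rewrite lee_fin !normrM mulrC ler_wpM2r//.
  by rewrite (le_trans (kB x))// ler_norm.
- exact: integrableZl.
Qed.

Lemma RintegralM_bounded d (T : measurableType d)
    (mu : {measure set T -> \bar R}) (rho k : T -> R) (B : R) :
  mu.-integrable setT (EFin \o rho) -> measurable_fun setT k ->
  (forall x, `|k x| <= B) ->
  `|\int[mu]_x (rho x * k x)| <= B * \int[mu]_x `|rho x|.
Proof.
move=> irho mk kB.
have irk := integrableM_bounded irho mk kB.
apply: (le_trans (le_normr_Rintegral _ irk)) => //.
rewrite -RintegralZl//; last exact: integrable_norm.
apply: le_Rintegral => //.
- exact: (integrable_norm irk).
- by apply: (integrableZl _ B (integrable_norm irho)).
- by move=> x _; rewrite normrM mulrC ler_wpM2r.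
Qed.

Lemma normr_expectation_le d (T : measurableType d) (P : probability T R)
    (g : T -> R) (B : R) :
  measurable_fun setT g -> (forall x, `|g x| <= B) ->
  `|\int[P]_x g x| <= B.
Proof.
move=> mg gB.
have := @RintegralM_bounded _ _ P (cst 1) g B
  (finite_measure_integrable_cst P 1 measurableT) mg gB.
under eq_Rintegral do rewrite mul1r.
under [X in _ * X]eq_Rintegral do rewrite normr1.
by rewrite Rintegral_cst// mul1r [X in fine X]probability_setT mulr1.
Qed.

(** The law of [X] is absolutely continuous, and its Radon-Nikodym derivative equals [g] almost
    everywhere because both have the same integral over every measurable set. *)
Lemma integral_has_density d (T : measurableType d) (P : probability T R)
    (X : T -> R) (g phi : R -> R) :
  measurable_fun setT X -> has_density P X g -> measurable_fun setT phi ->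
  P.-integrable setT (fun t => (phi (X t))%:E) ->
  (\int[P]_t (phi (X t))%:E = \int[lebesgue_measure]_x (phi x * g x)%:E)%E.
Proof.
move=> mX [g0 mg dXg] mphi iphi.
have mX' : measurable_fun setT (X : T -> measurableTypeR R) by exact: mX.
pose X' : {mfun T >-> measurableTypeR R} :=
  HB.pack X (isMeasurableFun.Build _ _ _ _ _ mX').
pose nu : probability (measurableTypeR R) R := distribution P X'.
have numu : nu `<< @lebesgue_measure R.
  apply/null_content_dominatesP => A mA A0.
  rewrite [LHS]dXg//; apply: null_set_integral => //.
  exact/measurable_EFinP/measurable_funTS.
have <- : (\int[nu]_x (phi x)%:E = \int[P]_t (phi (X t))%:E)%E.
  by rewrite integral_distribution//; exact/measurable_EFinP.
rewrite -(Radon_Nikodym_change_of_variables numu)//; last first.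
  by apply: integrable_pushforward => //; exact/measurable_EFinP.
apply: ae_eq_integral => //.
- by apply: emeasurable_funM => //; exact/measurable_EFinP.
- by apply/measurable_EFinP; exact: measurable_funM.
- rewrite (_ : (fun x => (phi x * g x)%:E) = (EFin \o phi) \* (EFin \o g))%E//.
  apply: ae_eqe_mul2l; apply: integral_ae_eq => //.
  + exact: Radon_Nikodym_integrable.
  + exact/measurable_EFinP.
  + by move=> E _ mE; rewrite -Radon_Nikodym_integral//; exact: dXg.
Qed.

Lemma Rintegral_has_density d (T : measurableType d) (P : probability T R)
    (X : T -> R) (g phi : R -> R) (B : R) :
  measurable_fun setT X -> has_density P X g -> measurable_fun setT phi ->
  (forall x, `|phi x| <= B) ->
  \int[P]_t phi (X t) = \int[lebesgue_measure]_x (phi x * g x).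
Proof.
move=> mX dX mphi phiB; congr fine; apply: integral_has_density => //.
by apply: (@bounded_integrable _ _ _ _ B) => //; exact: measurableT_comp.
Qed.

Lemma has_density_integrable d (T : measurableType d) (P : probability T R)
    (X : T -> R) (g : R -> R) :
  has_density P X g -> lebesgue_measure.-integrable setT (EFin \o g).
Proof.
move=> [g0 mg dXg]; apply/integrableP; split; first exact/measurable_EFinP.
under eq_integral do rewrite /= ger0_norm//.
by rewrite -dXg// preimage_setT probability_setT ltry.
Qed.

Lemma has_density_Rintegral d (T : measurableType d) (P : probability T R)
    (X : T -> R) (g : R -> R) :
  has_density P X g -> \int[lebesgue_measure]_x g x = 1.
Proof.
by move=> [g0 mg dXg]; rewrite /Rintegral -dXg// preimage_setT probability_setT.
Qed.

(** The product is absolutely integrable because the inner integral of [|rho x * k (x, t)|] is at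
    most [B * |rho x|]. *)
Lemma Fubini_bounded d (T : measurableType d) (P : probability T R) d'
    (T' : measurableType d') (mu : {sigma_finite_measure set T' -> \bar R})
    (rho : T' -> R) (k : T' * T -> R) (B : R) :
  mu.-integrable setT (EFin \o rho) -> measurable_fun setT k ->
  (forall z, `|k z| <= B) ->
  \int[mu]_x (rho x * \int[P]_t k (x, t)) =
  \int[P]_t \int[mu]_x (rho x * k (x, t)).
Proof.
move=> irho mk kB.
have mrho : measurable_fun setT rho by exact/measurable_EFinP/(measurable_int mu).
have mk1 x : measurable_fun setT (fun t => k (x, t)) by exact: measurableT_comp.
have mk2 t : measurable_fun setT (fun x => k (x, t)) by exact: measurableT_comp.
pose F (z : T' * T) := (rho z.1 * k z)%:E.
have mF : measurable_fun setT F.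
  by apply/measurable_EFinP/measurable_funM => //; exact: measurableT_comp.
have ik x : P.-integrable setT (fun t => (k (x, t))%:E).
  exact: (@bounded_integrable _ _ _ _ B).
have Flty : (\int[mu]_x \int[P]_t `|F (x, t)| < +oo)%E.
  have : mu.-integrable setT (fun x => B%:E * (`|rho x|)%:E)%E.
    by apply: integrableZl => //; exact: integrable_norm.
  move=> /integrableP[_]; apply: le_lt_trans; apply: ge0_le_integral => //.
  - by move=> x _; exact: integral_ge0.
  - apply: (@measurable_fun_fubini_tonelli_F _ _ _ _ _  P (abse \o F)) => //.
      exact: measurableT_comp.
    by move=> z; rewrite /= lee_fin.
  - apply: measurableT_comp => //; apply: emeasurable_funM => //.
    by apply/measurable_EFinP; exact: measurableT_comp.
  - move=> x _; apply: (@le_trans _ _ (\int[P]_y (`|rho x| * B)%:E)%E).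
      apply: ge0_le_integral => //.
      + apply: measurableT_comp => //; apply/measurable_EFinP.
        by rewrite /=; apply: measurable_funM.
      + by move=> t _ /=; rewrite lee_fin normrM ler_wpM2l.
    rewrite integral_cst//= probability_setT mule1 lee_fin.
    by rewrite normrM normr_id mulrC ler_wpM2r// ler_norm.
rewrite /Rintegral; congr fine.
transitivity (\int[mu]_x \int[P]_t F (x, t))%E.
  apply: eq_integral => x _; rewrite /F /= EFinM fineK ?integrable_fin_num//.
  by rewrite -integralZl.
rewrite (Fubini ((integrable12ltyP mu P mF).2 Flty)).
apply: eq_integral => t _.
rewrite fineK// integrable_fin_num//.
exact: (integrableM_bounded irho (mk2 t) (fun x => kB (x, t))).
Qed.

(** Adding [B] makes the integrand nonnegative, so that Tonelli gives measurability; the added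
    constant integrates to [B] and is subtracted again. *)
Lemma measurable_expectation d (T : measurableType d) (P : probability T R) d'
    (T' : measurableType d') (k : T' * T -> R) (B : R) :
  measurable_fun setT k -> (forall z, `|k z| <= B) ->
  measurable_fun setT (fun x => \int[P]_t k (x, t)).
Proof.
move=> mk kB.
have mk1 x : measurable_fun setT (fun t => k (x, t)) by exact: measurableT_comp.
rewrite (_ : (fun x => _) =
    (fun x => \int[P]_t (k (x, t) + B) - B)); last first.
  apply/funext => x; rewrite RintegralD//.
  - by rewrite Rintegral_cst// [X in fine X]probability_setT mulr1 addrK.
  - exact: (@bounded_integrable _ _ _ _ B).
  - exact: finite_measure_integrable_cst.
apply: measurable_funB => //.
apply: (measurableT_comp (f := fine)) => //.
apply: (@measurable_fun_fubini_tonelli_F _ _ _ _ _ _ (fun z => (k z + B)%:E)) => //.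
- by apply/measurable_EFinP; exact: measurable_funD.
- by move=> z; rewrite lee_fin -lerBlDr sub0r; have := kB z; rewrite ler_norml => /andP[].
Qed.

End integration_tools.
Arguments bounded_integrable {R d T P g} B.

(** * Affine changes of variable for Lebesgue measure *)

Section lebesgue_affine.
Context {R : realType}.
Local Notation mu := (@lebesgue_measure R).

Lemma measurable_fun_integrable (f : R -> R) :
  mu.-integrable setT (EFin \o f) -> measurable_fun setT f.
Proof. by move=> /measurable_int /measurable_EFinP. Qed.

(** By uniqueness of Lebesgue measure it suffices to compare half-open intervals. For [c < 0] the
    preimage is half-open on the other side, which does not change its length. *)
Lemma lebesgue_measure_affine (c b : R) (A : set R) : c != 0 -> measurable A ->
  mu A = (`|c|%:E * mu ((fun x => c * x + b)%R @^-1` A))%E.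
Proof.
move=> c0 mA.
have mf : measurable_fun setT
    ((fun x => c * x + b) : measurableTypeR R -> measurableTypeR R).
  by apply: measurable_funD => //; exact: measurable_funM.
pose nu : {measure set (measurableTypeR R) -> \bar R} :=
  measure_function_pushforward__canonical__measure_function_Measure mu mf.
pose k : {nonneg R} := NngNum (normr_ge0 c).
apply: (@lebesgue_measure_unique _ (mscale k nu)) => // _ [[u v]] _ <-.
rewrite -[RHS]/(`|c|%:E * mu ((fun x => c * x + b)%R @^-1` `]u, v]))%E.
have [cp|cn|cz] := ltgtP 0 c; last by rewrite -cz eqxx in c0.
- rewrite (_ : _ @^-1` _ = [set` `](u - b) / c, (v - b) / c]]); last first.
    apply/seteqP; split => x /=; rewrite !in_itv /= => /andP[H1 H2];
      rewrite ?ltr_pdivrMr ?ler_pdivlMr// in H1 H2 *; apply/andP; split; lra.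
  rewrite !lebesgue_measure_itv /= !lte_fin ltr_pM2r ?invr_gt0// ltrD2r.
  case: ifPn => _; last by rewrite mule0.
  rewrite -!EFinB -EFinM gtr0_norm//; congr EFin; field.
  by rewrite gt_eqF.
- rewrite (_ : _ @^-1` _ = [set` `[(v - b) / c, (u - b) / c[]); last first.
    apply/seteqP; split => x /=; rewrite !in_itv /= => /andP[H1 H2];
      rewrite ?ltr_ndivlMr ?ler_ndivrMr// in H1 H2 *; apply/andP; split; lra.
  rewrite !lebesgue_measure_itv /= !lte_fin ltr_nM2r ?invr_lt0// ltrD2r.
  case: ifPn => _; last by rewrite mule0.
  rewrite -!EFinB -EFinM ltr0_norm//; congr EFin; field.
  by rewrite lt_eqF.
Qed.

Lemma measurable_fun_affine (f : R -> R) (c b : R) : measurable_fun setT f ->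
  measurable_fun setT (fun x => f (c * x + b)).
Proof.
move=> mf; apply: measurableT_comp => //.
by apply: measurable_funD => //; exact: measurable_funM.
Qed.

Lemma ge0_integral_affine (f : R -> R) (c b : R) : c != 0 ->
  measurable_fun setT f -> (forall x, 0 <= f x) ->
  (\int[mu]_x (f x)%:E = `|c|%:E * \int[mu]_x (f (c * x + b))%R%:E)%E.
Proof.
move=> c0 mf f0.
have ma : measurable_fun setT
    ((fun x => c * x + b) : measurableTypeR R -> measurableTypeR R).
  by apply: measurable_funD => //; exact: measurable_funM.
pose nu : {measure set (measurableTypeR R) -> \bar R} :=
  measure_function_pushforward__canonical__measure_function_Measure mu ma.
pose k : {nonneg R} := NngNum (normr_ge0 c).
have mEf : measurable_fun setT (EFin \o f : measurableTypeR R -> \bar R).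
  exact/measurable_EFinP.
transitivity (\int[mscale k nu]_x (f x)%:E)%E.
  by apply: eq_measure_integral => A mA _; exact: lebesgue_measure_affine.
rewrite (ge0_integral_mscale nu measurableT k mEf); last first.
  by move=> x _; rewrite /= lee_fin.
congr (_ * _)%E.
by rewrite ge0_integral_pushforward// => x _; rewrite lee_fin.
Qed.

Lemma integrable_affine (f : R -> R) (c b : R) : c != 0 ->
  mu.-integrable setT (EFin \o f) ->
  mu.-integrable setT (fun x => (f (c * x + b))%:E).
Proof.
move=> c0 fi; have mf := measurable_fun_integrable fi.
apply/integrableP; split; first by apply/measurable_EFinP; exact: (measurable_fun_affine c b mf).
move/integrableP: fi => [_].
rewrite (@ge0_integral_affine (fun x => `|f x|) c b)//; last exact: measurableT_comp.
have c1 : 0 < `|c| by rewrite normr_gt0.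
move=> H; rewrite -(lte_pmul2l (z := `|c|%:E))//.
by rewrite (lt_le_trans H)// mulry gtr0_sg// mul1e.
Qed.

Lemma Rintegral_affine (f : R -> R) (c b : R) : c != 0 ->
  mu.-integrable setT (EFin \o f) ->
  \int[mu]_x f x = `|c| * \int[mu]_x f (c * x + b).
Proof.
move=> c0 fi; have mf := measurable_fun_integrable fi.
have fci := integrable_affine b c0 fi.
have mn : measurable_fun setT (fun x => `|f x|) by exact: measurableT_comp.
(* Writing [f] as the difference of the nonnegative functions [f + |f|] and [|f|] reduces the claim
   to nonnegative integrands. *)
rewrite (_ : \int[mu]_x f x = \int[mu]_x ((f x + `|f x|) - `|f x|)); last first.
  by apply: eq_Rintegral => x _; rewrite addrK.
rewrite (_ : \int[mu]_x f (c * x + b) =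
    \int[mu]_x ((f (c * x + b) + `|f (c * x + b)|) - `|f (c * x + b)|)); last first.
  by apply: eq_Rintegral => x _; rewrite addrK.
have in1 := integrable_norm fi.
have in2 := integrable_norm fci.
rewrite RintegralB//; last exact: (integrableD _ fi in1).
rewrite [in RHS]RintegralB//; last exact: (integrableD _ fci in2).
rewrite mulrBr; congr (_ - _); rewrite /Rintegral.
- rewrite (@ge0_integral_affine (fun x => f x + `|f x|) c b)//.
  + by rewrite fineM//; apply: integrable_fin_num => //; exact: (integrableD _ fci in2).
  + exact: measurable_funD.
  + by move=> x; rewrite addrC -lerBlDr sub0r -normrN ler_norm.
- rewrite (@ge0_integral_affine (fun x => `|f x|) c b)//.
  by rewrite fineM//; exact: integrable_fin_num.
Qed.

End lebesgue_affine.

(** * Consequences of independence *)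

Section independence.
Context {R : realType} d (T : measurableType d) (P : probability T R).

Lemma bounded_convergence (f_ : nat -> T -> R) (f : T -> R) (B : R) :
  (forall n, measurable_fun setT (f_ n)) -> measurable_fun setT f ->
  {ae P, forall t, f_ ^~ t @ \oo --> f t} ->
  (forall n t, `|f_ n t| <= B) ->
  (fun n => \int[P]_t f_ n t) @ \oo --> \int[P]_t f t.
Proof.
move=> mf_ mf cf fB.
have [//|||||fi _ cvgi] := @dominated_convergence _ _ _ P setT measurableT
  (fun n => EFin \o f_ n) (EFin \o f) (EFin \o cst B).
- by move=> n; exact/measurable_EFinP.
- exact/measurable_EFinP.
- by apply: filterS cf => t /= ft _; apply: cvg_EFin ft; exact: nearW.
- exact: finite_measure_integrable_cst.
- by apply/aeW => t n _ /=; rewrite lee_fin.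
apply: fine_cvg; rewrite fineK//; exact: integrable_fin_num.
Qed.

(** Both sides are finite measures in [D], the left one being [P] restricted to [E] and pushed
    forward. They agree on rectangles, a generating family stable under intersection. *)
Lemma indep_pair_event (U V : T -> R) (E : set T) :
  measurable_fun setT U -> measurable_fun setT V -> measurable E ->
  (forall A B, measurable A -> measurable B ->
    P (U @^-1` A `&` V @^-1` B `&` E) = (P (U @^-1` A `&` V @^-1` B) * P E)%E) ->
  forall D : set (R * R), measurable D ->
    P ((fun t => (U t, V t)) @^-1` D `&` E) =
    (P ((fun t => (U t, V t)) @^-1` D) * P E)%E.
Proof.
move=> mU mV mE UVE D mD.
have mUV : measurable_fun setT (fun t => (U t, V t)) by exact: measurable_fun_pair.
pose m2 : {measure set (R * R)%type -> \bar R} :=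
  measure_function_pushforward__canonical__measure_function_Measure (mrestr P mE) mUV.
pose m0 : {measure set (R * R)%type -> \bar R} :=
  measure_function_pushforward__canonical__measure_function_Measure P mUV.
have PE0 : 0 <= fine (P E) by rewrite fine_ge0.
pose k : {nonneg R} := NngNum PE0.
have PEk : k%:num%:E = P E by rewrite /k /= fineK ?fin_num_measure.
suff : mscale k m0 D = m2 D.
  by move=> H; rewrite -[LHS]/(m2 D) -H /mscale PEk muleC.
pose C : set (set (R * R)) := [set A `*` B | A in measurable & B in measurable].
apply: (measure_unique C (fun=> setT)) => //.
- exact: measurable_prod_measurableType.
- move=> _ _ [X1 mX1 [X2 mX2 <-]] [Y1 mY1 [Y2 mY2 <-]].
  rewrite -setXI; exists (X1 `&` Y1); first exact: measurableI.
  by exists (X2 `&` Y2) => //; exact: measurableI.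
- by move=> i; exists setT => //; exists setT => //; rewrite setXTT.
- by rewrite bigcup_const.
- move=> _ [X1 mX1 [X2 mX2 <-]].
  rewrite -[RHS]/(P (U @^-1` X1 `&` V @^-1` X2 `&` E)) UVE//.
  by rewrite -[LHS]/(k%:num%:E * P (U @^-1` X1 `&` V @^-1` X2))%E PEk muleC.
- move=> _; rewrite -[ltLHS]/(k%:num%:E * P setT)%E.
  by rewrite probability_setT mule1 ltry.
Qed.

(** The joint law of [U] and [V] is the product of their laws, and Fubini applies to it. *)
Lemma indep_Rintegral (U V : T -> R) (G : R * R -> R) (B : R) :
  measurable_fun setT U -> measurable_fun setT V ->
  (forall A B, measurable A -> measurable B ->
    P (U @^-1` A `&` V @^-1` B) = (P (U @^-1` A) * P (V @^-1` B))%E) ->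
  measurable_fun setT G -> (forall z, `|G z| <= B) ->
  \int[P]_t G (U t, V t) = \int[P]_t \int[P]_s G (U t, V s).
Proof.
move=> mU mV UV mG GB.
have mUV : measurable_fun setT (fun t => (U t, V t)) by exact: measurable_fun_pair.
pose U' : {mfun T >-> R} := HB.pack U (isMeasurableFun.Build _ _ _ _ _ mU).
pose V' : {mfun T >-> R} := HB.pack V (isMeasurableFun.Build _ _ _ _ _ mV).
pose mu1 : probability R R := distribution P U'.
pose mu2 : probability R R := distribution P V'.
pose m : {measure set (R * R)%type -> \bar R} :=
  measure_function_pushforward__canonical__measure_function_Measure P mUV.
have mEG : measurable_fun setT (EFin \o G) by exact/measurable_EFinP.
have mG1 x : measurable_fun setT (fun y => G (x, y)) by exact: measurableT_comp.
have mGt t : measurable_fun setT (fun s => G (U t, V s)).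
  exact: (measurableT_comp (mG1 (U t))).
have iG t : P.-integrable setT (fun s => (G (U t, V s))%:E).
  exact: (bounded_integrable B).
rewrite /Rintegral; congr fine.
transitivity (\int[m]_z (G z)%:E)%E.
  rewrite (integral_pushforward mUV mEG)//; rewrite preimage_setT.
  by apply: (bounded_integrable B) => //; exact: measurableT_comp.
transitivity (\int[(mu1 \x mu2)%E]_z (G z)%:E)%E.
  apply: eq_measure_integral => D mD _; apply/esym/product_measure_unique => //.
have iGp : (mu1 \x mu2)%E.-integrable setT (EFin \o G).
  apply: (bounded_integrable B).
  - exact: mG.
  - exact: GB.
rewrite -(integral12_prod_meas1 iGp) /fubini_F /=.
have inner x : (\int[mu2]_y (G (x, y))%:E = \int[P]_s (G (x, V s))%:E)%E.
  rewrite (integral_distribution (X := V'))//; first exact/measurable_EFinP.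
  by apply: (bounded_integrable B) => //; exact: (measurableT_comp (mG1 x)).
under eq_integral do rewrite inner.
have iGx x : P.-integrable setT (fun s => (G (x, V s))%:E).
  by apply: (bounded_integrable B) => //; exact: (measurableT_comp (mG1 x)).
pose F x := \int[P]_s G (x, V s).
have mF : measurable_fun setT F.
  apply: (@measurable_expectation _ _ _ _ _ _ (fun z => G (z.1, V z.2)) B) => //.
  apply: measurableT_comp => //; apply: measurable_fun_pair => //.
  exact: measurableT_comp.
have FE x : (\int[P]_s (G (x, V s))%:E = (F x)%:E)%E.
  by rewrite fineK// integrable_fin_num.
under eq_integral do rewrite FE.
rewrite (integral_distribution (X := U'))//; first exact/measurable_EFinP.
apply: (bounded_integrable B); first exact: measurableT_comp.
by move=> t; apply: normr_expectation_le => //; exact: (measurableT_comp (mG1 _)).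
Qed.

(** * Finite linear forms in the innovations *)

Definition linear_form (eps : int -> T -> R) (b : int -> R) (J : seq int) (t : T)
  : R := \sum_(j <- J) b j * eps j t.

Section sums.
Variables (eps : int -> T -> R) (feps : R -> R) (b : int -> R).
Hypothesis meps : forall i, measurable_fun setT (eps i).
Hypothesis ieps : mutual_indep P eps.
Hypothesis deps : forall i, has_density P (eps i) feps.

Lemma measurable_linear_form (J : seq int) :
  measurable_fun setT (linear_form eps b J).
Proof.
by apply: measurable_sum => j; apply: measurable_funM.
Qed.

(** The events on [L] strengthen the induction. The form over [i :: J] is a function of the pair
    formed by the form over [J] and [eps i]; on a rectangle the condition on [eps i] moves into the
    list of events, where the induction hypothesis and mutual independence apply. *)
Lemma indep_linear_form (J L : seq int) : uniq (J ++ L) ->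
  forall (C : set R) (B : int -> set R), measurable C ->
    (forall i, i \in L -> measurable (B i)) ->
  P (linear_form eps b J @^-1` C `&`
     \bigcap_(i in [set i | i \in L]) (eps i @^-1` B i)) =
  (P (linear_form eps b J @^-1` C) *
   P (\bigcap_(i in [set i | i \in L]) (eps i @^-1` B i)))%E.
Proof.
elim: J L => [|i J IH] L uL C B mC mB.
  rewrite (_ : linear_form eps b [::] = cst 0); last first.
    by apply/funext => t; rewrite /linear_form big_nil.
  rewrite preimage_cst; case: ifPn => _.
    by rewrite setTI probability_setT mul1e.
  by rewrite set0I measure0 mul0e.
have mE (L' : seq int) B' : (forall i, i \in L' -> measurable (B' i)) ->
    measurable (\bigcap_(i in [set i | i \in L']) (eps i @^-1` B' i)).
  move=> mB'; apply: fin_bigcap_measurable => // j jL'.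
  by rewrite -[X in measurable X]setTI; apply: meps => //; exact: mB'.
have uJ : uniq (J ++ i :: L).
  by rewrite -(cat1s i L) uniq_catCA.
set S := linear_form eps b J.
have mS : measurable_fun setT S by exact: measurable_linear_form.
pose D := [set z : R * R | C (b i * z.2 + z.1)].
have mD : measurable D.
  rewrite -[X in measurable X]setTI.
  have mh : measurable_fun setT (fun z : R * R => b i * z.2 + z.1).
    by apply: measurable_funD => //; exact: measurable_funM.
  exact: mh.
have SE : linear_form eps b (i :: J) @^-1` C =
    (fun t => (S t, eps i t)) @^-1` D.
  by apply/seteqP; split => t /=; rewrite /linear_form big_cons.
rewrite SE; apply: indep_pair_event => //; first exact: mE.
move=> A1 A2 mA1 mA2.
pose B' j := if j == i then A2 else B j.
have mB' j : j \in i :: L -> measurable (B' j).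
  by rewrite inE /B'; case: eqP => //= _; exact: mB.
have iL : i \notin L by move: uL; rewrite /= mem_cat negb_or => /andP[/andP[]].
have capE : \bigcap_(j in [set j | j \in i :: L]) (eps j @^-1` B' j) =
    eps i @^-1` A2 `&` \bigcap_(j in [set j | j \in L]) (eps j @^-1` B j).
  apply/seteqP; split => t.
    move=> H; split.
      by have := H i; rewrite /B' /= eqxx; apply; rewrite inE eqxx.
    move=> j /= jL; have := H j; rewrite /B' /=.
    case: eqP => [ji|_]; first by rewrite -ji jL in iL.
    by apply; rewrite inE jL orbT.
  move=> [H1 H2] j /=; rewrite inE /B'; case: eqP => [->//|_ /= jL].
  exact: H2.
have capi (A : set R) : measurable A ->
    \bigcap_(j in [set j | j \in [:: i]]) (eps j @^-1` A) = eps i @^-1` A.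
  move=> _; apply/seteqP; split => t; first by apply; rewrite /= inE.
  by move=> H j /=; rewrite inE => /eqP ->.
have Pcap : P (\bigcap_(j in [set j | j \in i :: L]) (eps j @^-1` B' j)) =
    (P (eps i @^-1` A2) * P (\bigcap_(j in [set j | j \in L]) (eps j @^-1` B j)))%E.
  rewrite ieps//; last by rewrite cons_uniq iL; move: uL; rewrite cat_uniq => /and3P[].
  rewrite big_cons {1}/B' eqxx ieps//; last by move: uL; rewrite cat_uniq => /and3P[].
  congr (_ * _)%E; rewrite big_seq [RHS]big_seq; apply: eq_bigr => j jL.
  by rewrite /B'; case: eqP => // ji; rewrite -ji jL in iL.
have uJi : uniq (J ++ [:: i]).
  move: uL; rewrite /= mem_cat negb_or cat_uniq => /andP[/andP[iJ _] /and3P[uJ' _ _]].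
  by rewrite cats1 rcons_uniq iJ.
have H1 := IH _ uJ A1 B' mA1 mB'.
have H2 := IH _ uJi A1 (fun=> A2) mA1 (fun _ _ => mA2).
rewrite capi// in H2.
by rewrite H2 -setIA -capE H1 Pcap muleA.
Qed.

(** The smoothing operator of one innovation with coefficient [s]. Innovation [0] stands for all of
    them, as they are identically distributed. *)
Definition avg (s : R) (g : R -> R) (y : R) : R := \int[P]_t g (y + s * eps 0 t).

Lemma eps_identically_distributed (i : int) (phi : R -> R) (B : R) :
  measurable_fun setT phi -> (forall x, `|phi x| <= B) ->
  \int[P]_t phi (eps i t) = \int[P]_t phi (eps 0 t).
Proof.
move=> mphi phiB.
by rewrite !(Rintegral_has_density (meps _) (deps _) mphi phiB).
Qed.

Lemma measurable_fun_shift (g : R -> R) (s y : R) : measurable_fun setT g ->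
  measurable_fun setT (fun x => g (y + s * x)).
Proof.
move=> mg; apply: measurableT_comp => //.
by apply: measurable_funD => //; exact: measurable_funM.
Qed.

Lemma measurable_avg (g : R -> R) (s B : R) :
  measurable_fun setT g -> (forall x, `|g x| <= B) ->
  measurable_fun setT (avg s g).
Proof.
move=> mg gB.
rewrite /avg; apply: (@measurable_expectation _ _ _ P _ _
  (fun z : R * T => g (z.1 + s * eps 0 z.2)) B) => //.
apply: measurableT_comp => //; apply: measurable_funD => //.
by apply: measurable_funM => //; exact: measurableT_comp.
Qed.

Lemma avg_bounded (g : R -> R) (s B : R) :
  measurable_fun setT g -> (forall x, `|g x| <= B) ->
  forall y, `|avg s g y| <= B.
Proof.
move=> mg gB y; apply: normr_expectation_le => //.
by apply: (measurableT_comp (measurable_fun_shift s y mg)).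
Qed.

(** Independence allows the innovations to be integrated out one at a time, the head of the list
    first. From here on decoupling is a matter of comparing compositions of averaging operators. *)
Lemma expectation_linear_form (J : seq int) (g : R -> R) (B y : R) :
  uniq J -> measurable_fun setT g -> (forall x, `|g x| <= B) ->
  \int[P]_t g (y + linear_form eps b J t) =
  foldl (fun g j => avg (b j) g) g J y.
Proof.
elim: J g => [|i J IH] g uJ mg gB.
  under eq_Rintegral do rewrite /linear_form big_nil addr0.
  by rewrite Rintegral_cst// [X in fine X]probability_setT mulr1.
have [iJ uJ'] : i \notin J /\ uniq J by move: uJ => /= /andP.
rewrite /= -IH//; [|exact: measurable_avg gB|exact: avg_bounded].
set S := linear_form eps b J.
have mS : measurable_fun setT S by exact: measurable_linear_form.
pose G (z : R * R) := g (y + z.1 + b i * z.2).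
have mG : measurable_fun setT G.
  apply: measurableT_comp => //; apply: measurable_funD.
    exact: measurable_funD.
  exact: measurable_funM.
transitivity (\int[P]_t G (S t, eps i t)).
  by apply: eq_Rintegral => t _; rewrite /G /= /linear_form big_cons [in RHS]addrAC addrA.
rewrite (@indep_Rintegral S (eps i) G B mS (meps i) _ mG); last first.
- by move=> z; exact: gB.
- move=> A1 A2 mA1 mA2.
  have uJi : uniq (J ++ [:: i]) by rewrite cats1 rcons_uniq iJ.
  have := @indep_linear_form _ _ uJi A1 (fun=> A2) mA1 (fun _ _ => mA2).
  rewrite (_ : \bigcap_(j in _) _ = eps i @^-1` A2)//.
  apply/seteqP; split => t; first by apply; rewrite /= inE.
  by move=> H j /=; rewrite inE => /eqP ->.
- apply: eq_Rintegral => t _; rewrite /avg /G /=.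
  rewrite (@eps_identically_distributed i (fun x => g (y + S t + b i * x)) B)//.
  exact: measurable_fun_shift.
Qed.

End sums.
End independence.

(** A derivative-free form of a bound [M] on the second derivative. It passes through averages and
    correlations without differentiation under the integral. *)
Definition sdiff2 {R : realType} (M : R) (g : R -> R) : Prop :=
  forall y s t, `|g (y + s + t) - g (y + s) - g (y + t) + g y| <= M * `|s| * `|t|.

Ltac solve_integrable :=
  repeat first [ done | exact: finite_measure_integrable_cst
    | apply: integrable_funB | apply: integrable_funD | apply: integrable_funZ ].

(** * Replacing shared innovations by independent copies *)

Section decoupling.
Context {R : realType} d (T : measurableType d) (P : probability T R).
Variables (eps : int -> T -> R) (feps : R -> R).
Hypothesis meps : forall i, measurable_fun setT (eps i).
Hypothesis ieps : mutual_indep P eps.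
Hypothesis deps : forall i, has_density P (eps i) feps.
Hypothesis i2eps : P.-integrable setT (fun t => (eps 0 t ^+ 2)%:E).

Local Notation A := (avg P eps).

Lemma avg_integrable (g : R -> R) (B s y : R) : measurable_fun setT g ->
  (forall x, `|g x| <= B) -> P.-integrable setT (EFin \o (fun t => g (y + s * eps 0 t))).
Proof.
move=> mg gB; apply: (bounded_integrable B) => //.
exact: (measurableT_comp (measurable_fun_shift s y mg)).
Qed.

Lemma sdiff2_avg (g : R -> R) (B M s : R) : measurable_fun setT g ->
  (forall x, `|g x| <= B) -> sdiff2 M g -> sdiff2 M (A s g).
Proof.
move=> mg gB gM y u v.
have ig z := avg_integrable s z mg gB.
have i1 := integrable_funB measurableT (ig (y + u + v)) (ig (y + u)).
have i2 := integrable_funB measurableT i1 (ig (y + v)).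
rewrite /avg -RintegralB// -RintegralB// -RintegralD//.
apply: normr_expectation_le.
  apply: measurable_funD; last exact: (measurableT_comp (measurable_fun_shift s _ mg)).
  apply: measurable_funB; last exact: (measurableT_comp (measurable_fun_shift s _ mg)).
  by apply: measurable_funB; exact: (measurableT_comp (measurable_fun_shift s _ mg)).
move=> t; have := gM (y + s * eps 0 t) u v.
by congr (`|_ - _ - _ + _| <= _); congr g; ring.
Qed.

(* Adding the vanishing difference of [\int g (y - c e)] and
   [\int\int g (y - c e')] turns the integrand into a second-order difference. *)
Lemma avg_decouple (g : R -> R) (B M b c y : R) : measurable_fun setT g ->
  (forall x, `|g x| <= B) -> 0 <= M -> sdiff2 M g ->
  `|A (b - c) g y - A b (A (- c) g) y| <=
  2 * M * (\int[P]_t (eps 0 t ^+ 2)) * (`|b| * `|c|).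
Proof.
move=> mg gB M0 gM; set sig := \int[P]_t _.
have ig s z := avg_integrable s z mg gB.
have mAg := @measurable_avg _ _ _ P eps meps g (- c) B mg gB.
have Agb := @avg_bounded _ _ _ P eps meps g (- c) B mg gB.
have iAg z : P.-integrable setT (EFin \o (fun t => A (- c) g (z + b * eps 0 t))).
  exact: (avg_integrable b z mAg Agb).
pose Phi t s := g (y + (b - c) * eps 0 t) - g (y + b * eps 0 t + (- c) * eps 0 s)
  - g (y + (- c) * eps 0 t) + g (y + (- c) * eps 0 s).
have icst (r : R) : P.-integrable setT (EFin \o cst r).
  exact: finite_measure_integrable_cst.
have Ecst (r : R) : \int[P]__ r = r.
  by rewrite Rintegral_cst// [X in fine X]probability_setT mulr1.
have inner t : \int[P]_s Phi t s = g (y + (b - c) * eps 0 t)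
    - A (- c) g (y + b * eps 0 t) - g (y + (- c) * eps 0 t) + A (- c) g y.
  rewrite /Phi RintegralD//; last by solve_integrable.
  rewrite RintegralB//; [|by solve_integrable..].
  by rewrite RintegralB// ?Ecst; solve_integrable.
have -> : A (b - c) g y - A b (A (- c) g) y = \int[P]_t \int[P]_s Phi t s.
  under [RHS]eq_Rintegral do rewrite inner.
  rewrite RintegralD//; [|by solve_integrable..].
  rewrite RintegralB//; last by solve_integrable.
  by rewrite RintegralB// Ecst /avg subrK.
have iPhi t : P.-integrable setT (EFin \o (Phi t)).
  by rewrite /Phi; solve_integrable.
have i2 : P.-integrable setT (EFin \o (fun t => eps 0 t ^+ 2)) by [].
(* With [p = |eps 0 t|] and [q = |eps 0 s|] the second-order difference is at most
   [M |b| |c| p (p + q)], and [p (p + q) <= 3/2 p^2 + 1/2 q^2]. Integrated over both variables this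
   gives the factor 2. *)
have iG t : P.-integrable setT (EFin \o (fun s => M * (`|b| * `|c|) *
    (3 / 2 * eps 0 t ^+ 2 + 2^-1 * eps 0 s ^+ 2))).
  by solve_integrable.
have bnd t : `|\int[P]_s Phi t s| <=
    M * (`|b| * `|c|) * (3 / 2 * eps 0 t ^+ 2 + 2^-1 * sig).
  have -> : M * (`|b| * `|c|) * (3 / 2 * eps 0 t ^+ 2 + 2^-1 * sig) =
    \int[P]_s (M * (`|b| * `|c|) * (3 / 2 * eps 0 t ^+ 2 + 2^-1 * eps 0 s ^+ 2)).
    rewrite RintegralZl//; last by solve_integrable.
    rewrite RintegralD//; [|by solve_integrable..].
    by rewrite Ecst RintegralZl.
  apply: normr_Rintegral_dominated => // s _.
  rewrite /Phi.
  (* The base point is [y - c e'] and the increments are [b e] and [c (e' - e)]: the four values of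
     [g] in [Phi] are the corners of this parallelogram. *)
  have := gM (y + (- c) * eps 0 s) (b * eps 0 t) (- c * eps 0 t + c * eps 0 s).
  set e := eps 0 t; set e' := eps 0 s.
  have -> : y + - c * e' + b * e + (- c * e + c * e') = y + (b - c) * e by ring.
  have -> : y + - c * e' + b * e = y + b * e + - c * e' by ring.
  have -> : y + - c * e' + (- c * e + c * e') = y + - c * e by ring.
  move=> /le_trans; apply.
  have -> : - c * e + c * e' = c * (e' - e) by ring.
  rewrite !normrM.
  rewrite (_ : M * (`|b| * `|e|) * (`|c| * `|e' - e|) =
    M * (`|b| * `|c|) * (`|e| * `|e' - e|)); last by ring.
  apply: ler_wpM2l; first by rewrite !mulr_ge0.
  rewrite -normrM; rewrite -(real_normK (num_real e)) -(real_normK (num_real e')).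
  rewrite normrM; have := ler_normB e' e; have := normr_ge0 e; have := normr_ge0 e'.
  move: `|e| `|e'| `|e' - e| => p q r q0 p0 rqp.
  have := ler_wpM2l p0 rqp; have := sqr_ge0 (p - q); nra.
apply: (@le_trans _ _ (\int[P]_t (M * (`|b| * `|c|) * (3 / 2 * eps 0 t ^+ 2 + 2^-1 * sig)))).
  apply: normr_Rintegral_dominated => //.
    rewrite (_ : (fun t => _) = (fun t => g (y + (b - c) * eps 0 t)
      - A (- c) g (y + b * eps 0 t) - g (y + (- c) * eps 0 t) + A (- c) g y)); last first.
      exact/funext.
    by solve_integrable.
  by solve_integrable.
rewrite RintegralZl//; last by solve_integrable.
rewrite RintegralD//; [|by solve_integrable..].
rewrite RintegralZl// Ecst -/sig le_eqVlt; apply/orP; left; apply/eqP.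
by field.
Qed.

Lemma avgC (g : R -> R) (B r s : R) : measurable_fun setT g ->
  (forall x, `|g x| <= B) -> A r (A s g) = A s (A r g).
Proof.
move=> mg gB; apply/funext => y; rewrite /avg.
pose k (z : T * T) := g (y + r * eps 0 z.1 + s * eps 0 z.2).
have mk : measurable_fun setT k.
  apply: measurableT_comp => //; apply: measurable_funD; last first.
    by apply: measurable_funM => //; exact: measurableT_comp.
  apply: measurable_funD => //.
  by apply: measurable_funM => //; exact: measurableT_comp.
have /= := @Fubini_bounded _ _ _ P _ _ P (cst 1) k B
  (finite_measure_integrable_cst P 1 measurableT) mk (fun z => gB _).
under eq_Rintegral do rewrite mul1r.
move=> ->; apply: eq_Rintegral => t _; apply: eq_Rintegral => t' _.
by rewrite mul1r /k /= addrAC.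
Qed.

Section folds.
Variables (al be : int -> R) (B M : R).
Hypothesis M0 : 0 <= M.

(** For two forms with coefficients [al] and [be], [U] averages their difference when they share the
    innovations, [V] when the second uses independent copies; [VA] and [VB] average over one form
    only. *)
Let U := foldl (fun g j => A (al j - be j) g).
Let V := foldl (fun g j => A (al j) (A (- be j) g)).
Let VA := foldl (fun g j => A (al j) g).
Let VB := foldl (fun g j => A (- be j) g).

(** Averaging contracts the supremum norm, so an error made at one innovation is not amplified by
    the averages over the others. *)
Lemma foldl_avg_contract (J : seq int) (g1 g2 : R -> R) (del : R) :
  measurable_fun setT g1 -> (forall x, `|g1 x| <= B) ->
  measurable_fun setT g2 -> (forall x, `|g2 x| <= B) ->
  (forall x, `|g1 x - g2 x| <= del) -> forall y, `|V g1 J y - V g2 J y| <= del.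
Proof.
have contr s (f1 f2 : R -> R) : measurable_fun setT f1 -> (forall x, `|f1 x| <= B) ->
    measurable_fun setT f2 -> (forall x, `|f2 x| <= B) ->
    (forall x, `|f1 x - f2 x| <= del) -> forall x, `|A s f1 x - A s f2 x| <= del.
  move=> mf1 f1B mf2 f2B f12 x.
  have i1 := avg_integrable s x mf1 f1B; have i2 := avg_integrable s x mf2 f2B.
  rewrite /avg -RintegralB//; apply: normr_expectation_le => //.
  by apply: measurable_funB; [exact: (measurableT_comp (measurable_fun_shift s _ mf1))|exact: (measurableT_comp (measurable_fun_shift s _ mf2))].
elim: J g1 g2 => [//|i J IH] g1 g2 m1 b1 m2 b2 g12.
have mA (f : R -> R) s : measurable_fun setT f -> (forall x, `|f x| <= B) ->
  measurable_fun setT (A s f) by move=> ? ?; exact: measurable_avg.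
have bA (f : R -> R) s : measurable_fun setT f -> (forall x, `|f x| <= B) ->
  forall x, `|A s f x| <= B by move=> ? ?; exact: avg_bounded.
apply: IH; [by apply: (mA _ _); [exact: mA|exact: bA]|by apply: (bA _ _); [exact: mA|exact: bA]
  |by apply: (mA _ _); [exact: mA|exact: bA]|by apply: (bA _ _); [exact: mA|exact: bA]|].
by apply: (contr _ _ _); [exact: mA|exact: bA|exact: mA|exact: bA|exact: contr].
Qed.

(** The innovations are decoupled in turn. Each costs its own term of the sum, with the same [M]
    throughout because averaging preserves [sdiff2 M]. *)
Lemma foldl_avg_decouple (J : seq int) (g : R -> R) :
  measurable_fun setT g -> (forall x, `|g x| <= B) -> sdiff2 M g ->
  forall y, `|U g J y - V g J y| <=
    2 * M * (\int[P]_t (eps 0 t ^+ 2)) * \sum_(j <- J) (`|al j| * `|be j|).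
Proof.
have mA (f : R -> R) s : measurable_fun setT f -> (forall x, `|f x| <= B) ->
  measurable_fun setT (A s f) by move=> ? ?; exact: measurable_avg.
have bA (f : R -> R) s : measurable_fun setT f -> (forall x, `|f x| <= B) ->
  forall x, `|A s f x| <= B by move=> ? ?; exact: avg_bounded.
elim: J g => [|i J IH] g mg gB gM y; first by rewrite big_nil mulr0 subrr normr0.
rewrite big_cons mulrDr /=.
apply: (le_trans (ler_distD (V (A (al i - be i) g) J y) _ _)).
rewrite addrC; apply: lerD; last first.
  by apply: IH; [exact: mA|exact: bA|exact: sdiff2_avg].
apply: foldl_avg_contract; [exact: mA|exact: bA|..].
- by apply: (mA _ _); [exact: mA|exact: bA].
- by apply: (bA _ _); [exact: mA|exact: bA].
- by move=> x; exact: (avg_decouple _ _ _ mg gB).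
Qed.

(** Averages commute, so those of the second form can all be carried out before those of the
    first. *)
Lemma foldl_avg_split (J : seq int) (g : R -> R) :
  measurable_fun setT g -> (forall x, `|g x| <= B) -> VA (VB g J) J = V g J.
Proof.
have mA (f : R -> R) s : measurable_fun setT f -> (forall x, `|f x| <= B) ->
  measurable_fun setT (A s f) by move=> ? ?; exact: measurable_avg.
have bA (f : R -> R) s : measurable_fun setT f -> (forall x, `|f x| <= B) ->
  forall x, `|A s f x| <= B by move=> ? ?; exact: avg_bounded.
have comm s (f : R -> R) J' : measurable_fun setT f -> (forall x, `|f x| <= B) ->
    A s (VB f J') = VB (A s f) J'.
  elim: J' f => [//|i J' IH] f mf fB /=.
  by rewrite IH; [rewrite (avgC _ _ mf fB)|exact: mA|exact: bA].
elim: J g => [//|i J IH] g mg gB /=.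
rewrite comm; [|exact: mA|exact: bA].
by apply: IH; [apply: (mA _ _); [exact: mA|exact: bA]|apply: (bA _ _); [exact: mA|exact: bA]].
Qed.

(** Innovation [i0] enters only the first form, as [be i0 = 0], and is averaged out before anything
    else. Smoothness is therefore required of [A (al i0) g] and not of [g]. *)
Lemma decoupling (i0 : int) (J : seq int) (g : R -> R) :
  uniq (i0 :: J) -> measurable_fun setT g -> (forall x, `|g x| <= B) ->
  be i0 = 0 -> sdiff2 M (A (al i0) g) ->
  `|\int[P]_t g (linear_form eps al (i0 :: J) t - linear_form eps be (i0 :: J) t) -
    \int[P]_t \int[P]_s
      g (linear_form eps al (i0 :: J) t - linear_form eps be (i0 :: J) s)| <=
  2 * M * (\int[P]_t (eps 0 t ^+ 2)) * \sum_(j <- J) (`|al j| * `|be j|).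
Proof.
move=> uJ mg gB be0 gM.
have mA (f : R -> R) s : measurable_fun setT f -> (forall x, `|f x| <= B) ->
  measurable_fun setT (A s f) by move=> ? ?; exact: measurable_avg.
have bA (f : R -> R) s : measurable_fun setT f -> (forall x, `|f x| <= B) ->
  forall x, `|A s f x| <= B by move=> ? ?; exact: avg_bounded.
have E1 : \int[P]_t g (linear_form eps al (i0 :: J) t - linear_form eps be (i0 :: J) t)
    = U (A (al i0) g) J 0.
  have -> : A (al i0) g = A (al i0 - be i0) g by rewrite be0 subr0.
  rewrite -[RHS]/(U g (i0 :: J) 0) /U.
  rewrite -(expectation_linear_form (fun j => al j - be j) meps ieps deps _ uJ mg gB).
  apply: eq_Rintegral => t _; rewrite add0r /linear_form -sumrB; congr g.
  by apply: eq_bigr => j _; rewrite mulrBl.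
have A0 : A 0 g = g.
  apply/funext => y; rewrite /avg; under eq_Rintegral do rewrite mul0r addr0.
  by rewrite Rintegral_cst// [X in fine X]probability_setT mulr1.
have E2 : \int[P]_t \int[P]_s
      g (linear_form eps al (i0 :: J) t - linear_form eps be (i0 :: J) s)
    = V (A (al i0) g) J 0.
  have -> : A (al i0) g = A (al i0) (A (- be i0) g) by rewrite be0 oppr0 A0.
  rewrite -[RHS]/(V g (i0 :: J) 0).
  rewrite -foldl_avg_split//.
  have [mVB VBb] : measurable_fun setT (VB g (i0 :: J)) /\
      forall x, `|VB g (i0 :: J) x| <= B.
    elim: (i0 :: J) g mg gB {gM A0 E1} => [//|j J' IH] f mf fB.
    by apply: IH; [exact: mA|exact: bA].
  rewrite /VA -(expectation_linear_form al meps ieps deps _ uJ mVB VBb).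
  apply: eq_Rintegral => t _; rewrite add0r.
  rewrite /VB -(expectation_linear_form (fun j => - be j) meps ieps deps _ uJ mg gB).
  apply: eq_Rintegral => s _; congr (g (_ + _)).
  by rewrite /linear_form -sumrN; apply: eq_bigr => j _; rewrite mulNr.
by rewrite E1 E2; apply: foldl_avg_decouple => //; [exact: mA|exact: bA].
Qed.

End folds.
End decoupling.

(** * From derivatives to increments *)

Section smoothness.
Context {R : realType}.

Lemma lipschitz_is_derive (f df : R -> R) (L : R) :
  (forall x : R, is_derive x (1 : R) f (df x)) -> (forall x, `|df x| <= L) ->
  forall x y, `|f y - f x| <= L * `|y - x|.
Proof.
move=> fdf dfL.
have cf (i : interval R) : {within [set` i], continuous f}.
  by apply: derivable_within_continuous => z _; exact: ex_derive.
have le_xy x y : x <= y -> `|f y - f x| <= L * `|y - x|.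
  move=> xy; have [c _ ->] := MVT_segment xy (fun z _ => fdf z) (cf `[x, y]).
  by rewrite normrM ler_wpM2r.
move=> x y; have [xy|/ltW yx] := leP x y; first exact: le_xy.
by rewrite distrC (distrC y); exact: le_xy.
Qed.

Lemma derivable_is_derive (f : R -> R) (x : R) :
  derivable f x 1 -> is_derive x (1 : R) f (derive1 f x).
Proof. by move=> dfx; rewrite derive1E; exact: DeriveDef. Qed.

(** The Lipschitz bound is applied to [derive1 f], and then to the increment [phi], whose derivative
    is thereby at most [M * |t|]. *)
Lemma sdiff2_derive1n (f : R -> R) (M : R) :
  (forall x, derivable f x 1) -> (forall x, derivable (derive1 f) x 1) ->
  (forall x, `|(derive1n 2 f) x| <= M) -> sdiff2 M f.
Proof.
move=> df ddf fM y s t.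
pose phi z := f (z + t) - f z.
have dphi (z : R) : is_derive z (1 : R) phi ((derive1 f) (z + t) - (derive1 f) z).
  have d1 : is_derive z (1 : R) (f \o (fun z => z + t)) ((derive1 f) (z + t)).
    have dz := derivable_is_derive (df (z + t)).
    have dg : is_derive z (1 : R) (fun z => z + t) (1 + 0).
      by apply: is_deriveD.
    have := @is_derive1_comp _ f (fun z => z + t) z _ _ dz dg.
    by rewrite addr0 mulr1.
  by apply: is_deriveB => //; exact: derivable_is_derive.
have Lip z : `|(derive1 f) (z + t) - (derive1 f) z| <= M * `|t|.
  have := @lipschitz_is_derive (derive1 f) (derive1n 2 f) M
    (fun x => derivable_is_derive (ddf x)) fM z (z + t).
  by rewrite addrAC subrr add0r.
have := lipschitz_is_derive dphi Lip y (y + s).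
rewrite /phi (addrC y s) addrK (addrC s y).
by rewrite mulrAC opprB addrA addrAC.
Qed.

Lemma hoelder_continuous (f : R -> R) (C r : R) : 0 < r ->
  (forall u v, `|f u - f v| <= C * `|u - v| `^ r) -> continuous f.
Proof.
move=> r0 fC x; apply/cvgrPdist_lt => e e0.
(* The sign of [C] is unknown; [D] is a positive constant above it. *)
pose D := `|C| + 1.
have D0 : 0 < D by rewrite ltr_wpDl.
have eD : 0 < e / D by rewrite divr_gt0.
have del0 : 0 < (e / D) `^ r^-1 by rewrite powR_gt0.
near=> z.
have xz : `|x - z| < (e / D) `^ r^-1.
  by near: z; exact: cvgr_dist_lt.
have : `|x - z| `^ r < e / D.
  have -> : e / D = ((e / D) `^ r^-1) `^ r.
    by rewrite -powRrM mulVf ?gt_eqF// powRr1// ltW.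
  by apply: gt0_ltr_powR => //; rewrite nnegrE ?powR_ge0.
rewrite ltr_pdivlMr// => H; apply: le_lt_trans (fC _ _) _; apply: le_lt_trans H.
rewrite mulrC ler_wpM2l ?powR_ge0// /D.
by apply: (le_trans (ler_norm C)); rewrite lerDl.
Unshelve. all: by end_near. Qed.

End smoothness.

(** * Autocorrelation of an integrable bounded kernel *)

Section autocorrelation.
Context {R : realType}.
Local Notation mu := (@lebesgue_measure R).
Variables (k : R -> R) (Bk : R).
Hypothesis ik : mu.-integrable setT (EFin \o k).
Hypothesis kB : forall x, `|k x| <= Bk.

Definition autocorr (y : R) : R := \int[mu]_x (k x * k (x + y)).

Let mk : measurable_fun setT k := measurable_fun_integrable ik.

Lemma measurable_kernel_shift (u : R) : measurable_fun setT (fun x : R => k (x + u)).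
Proof.
by have := measurable_fun_affine 1 u mk; under eq_fun do rewrite mul1r.
Qed.

Lemma integrable_kernel_shift (u : R) : mu.-integrable setT (EFin \o (fun x => k (x + u))).
Proof.
have := integrable_affine u (oner_neq0 R) ik.
by under eq_fun do rewrite mul1r.
Qed.

Lemma Rintegral_kernel_shift (u : R) (f : R -> R) : mu.-integrable setT (EFin \o f) ->
  \int[mu]_x f (x + u) = \int[mu]_x f x.
Proof.
move=> fi; rewrite (Rintegral_affine u (oner_neq0 R) fi) normr1 mul1r.
by under [RHS]eq_Rintegral do rewrite mul1r.
Qed.

Lemma autocorr_bounded (y : R) : `|autocorr y| <= Bk * \int[mu]_x `|k x|.
Proof. exact: (RintegralM_bounded ik (measurable_kernel_shift y)). Qed.

Lemma integrable_kernelM (u v : R) :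
  mu.-integrable setT (EFin \o (fun x => k (x + u) * k (x + v))).
Proof.
exact: (integrableM_bounded (integrable_kernel_shift u) (measurable_kernel_shift v)).
Qed.

(** Through this identity the integrated squared error depends on pairs of observations only by
    their differences. *)
Lemma Rintegral_kernelM (u v : R) :
  \int[mu]_x (k (x - u) * k (x - v)) = autocorr (u - v).
Proof.
rewrite -(Rintegral_kernel_shift u); last exact: (integrable_kernelM (- u) (- v)).
by apply: eq_Rintegral => x _; rewrite addrK addrA.
Qed.

Lemma autocorrN (y : R) : autocorr (- y) = autocorr y.
Proof.
rewrite -(sub0r y) -Rintegral_kernelM -[in RHS](subr0 y) -Rintegral_kernelM.
by apply: eq_Rintegral => x _; rewrite mulrC.
Qed.

(** The correlation inherits the modulus of continuity of one factor. It serves to make the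
    autocorrelation continuous, for measurability and for limits along truncated series; the
    constant may depend on the bandwidth. *)
Lemma autocorr_hoelder (C r : R) :
  (forall u v, `|k u - k v| <= C * `|u - v| `^ r) ->
  forall u v, `|autocorr u - autocorr v| <= (C * \int[mu]_x `|k x|) * `|u - v| `^ r.
Proof.
move=> kC u v; rewrite /autocorr -RintegralB//; last 2 first.
- by have := integrable_kernelM 0 u; under eq_fun do rewrite addr0.
- by have := integrable_kernelM 0 v; under eq_fun do rewrite addr0.
rewrite (_ : \int[mu]_x _ = \int[mu]_x (k x * (k (x + u) - k (x + v)))); last first.
  by apply: eq_Rintegral => x _; rewrite mulrBr.
rewrite mulrAC; apply: (RintegralM_bounded ik).
  exact: (measurable_funB (measurable_kernel_shift u) (measurable_kernel_shift v)).
move=> x; apply: le_trans (kC _ _) _.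
by rewrite opprD addrACA subrr add0r.
Qed.

End autocorrelation.

(** * Smoothing of the kernel by the innovation density *)

Section smoothing.
Context {R : realType} d (T : measurableType d) (P : probability T R).
Local Notation mu := (@lebesgue_measure R).
Variables (eps : int -> T -> R) (feps : R -> R).
Hypothesis meps : forall i, measurable_fun setT (eps i).
Hypothesis deps : forall i, has_density P (eps i) feps.
Variables (Bf M : R).
Hypothesis fepsB : forall x, `|feps x| <= Bf.
Hypothesis fepsM : sdiff2 M feps.
Variables (k : R -> R) (Bk : R).
Hypothesis ik : mu.-integrable setT (EFin \o k).
Hypothesis kB : forall x, `|k x| <= Bk.

Let mk : measurable_fun setT k := measurable_fun_integrable ik.

(** The substitution [z = w + a x] moves the dependence on [w] from the rough kernel to the smooth
    density. *)
Lemma avg_kernelE (a w : R) : a != 0 ->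
  avg P eps a k w = `|a|^-1 * \int[mu]_z (k z * feps (a^-1 * z + - (w / a))).
Proof.
move=> a0; have [_ mfeps _] := deps 0.
have msh := measurable_fun_shift a w mk.
rewrite /avg (Rintegral_has_density (meps 0) (deps 0) msh (fun x => kB _)).
have ikf : mu.-integrable setT
    (EFin \o (fun z => k z * feps (a^-1 * z + - (w / a)))).
  apply: (integrableM_bounded ik); last by move=> x; exact: fepsB.
  exact: measurable_fun_affine.
rewrite (Rintegral_affine w a0 ikf) mulrA mulVf ?normr_eq0// mul1r.
apply: eq_Rintegral => x _; rewrite (addrC w); congr (_ * feps _).
by field.
Qed.

(** One power of [1 / |a|] comes from the substitution, two from the increments [s / a] and [t / a]
    of the density. The kernel enters through its mass alone. *)
Lemma sdiff2_avg_kernel (a : R) : a != 0 ->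
  sdiff2 (M * \int[mu]_x `|k x| / `|a| ^+ 3) (avg P eps a k).
Proof.
move=> a0 y s t; have [_ mfeps _] := deps 0.
have mf w : measurable_fun setT (fun z => feps (a^-1 * z + - (w / a))).
  exact: measurable_fun_affine.
have ikf w : mu.-integrable setT
    (EFin \o (fun z => k z * feps (a^-1 * z + - (w / a)))).
  by apply: (integrableM_bounded ik (mf w)) => x; exact: fepsB.
have i1 := integrable_funB measurableT (ikf (y + s + t)) (ikf (y + s)).
have i2 := integrable_funB measurableT i1 (ikf (y + t)).
rewrite !avg_kernelE// -!mulrBr -mulrDr -RintegralB// -RintegralB// -RintegralD//.
rewrite (_ : \int[mu]_x _ = \int[mu]_x (k x * (feps (a^-1 * x + - ((y + s + t) / a)) -
  feps (a^-1 * x + - ((y + s) / a)) - feps (a^-1 * x + - ((y + t) / a)) +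
  feps (a^-1 * x + - (y / a))))); last first.
  by apply: eq_Rintegral => x _; ring.
have na0 : `|a| != 0 by rewrite normr_eq0.
rewrite normrM ger0_norm ?invr_ge0//.
rewrite (_ : _ * `|s| * `|t| =
  `|a|^-1 * (M * `|s / a| * `|t / a| * \int[mu]_x `|k x|)); last first.
  by rewrite !normrM !normfV; field.
apply: ler_wpM2l; first by rewrite invr_ge0.
apply: (RintegralM_bounded ik).
  exact: (measurable_funD (measurable_funB (measurable_funB (mf _) (mf _)) (mf _)) (mf _)).
move=> x; have := fepsM (a^-1 * x + - (y / a)) (- (s / a)) (- (t / a)).
rewrite !normrN; congr (`|feps _ - feps _ - feps _ + _| <= _); by field.
Qed.

Lemma avg_autocorr (a y : R) :
  avg P eps a (autocorr k) y = \int[mu]_x (k x * avg P eps a k (x + y)).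
Proof.
have mz : measurable_fun setT (fun z : R * T => k (z.1 + y + a * eps 0 z.2)).
  apply: measurableT_comp => //; apply: measurable_funD.
    exact: measurable_funD.
  by apply: measurable_funM => //; exact: measurableT_comp.
rewrite /avg (Fubini_bounded P ik mz (fun z => kB _)).
by apply: eq_Rintegral => t _; apply: eq_Rintegral => x _; rewrite /= addrA.
Qed.

(** Averaging acts on one of the two factors of the autocorrelation; integrating against the other
    one contributes the second power of the mass. *)
Lemma sdiff2_avg_autocorr (a : R) : a != 0 ->
  sdiff2 (M * (\int[mu]_x `|k x|) ^+ 2 / `|a| ^+ 3) (avg P eps a (autocorr k)).
Proof.
move=> a0 y s t.
have mA := measurable_avg P meps a mk kB.
have bA := avg_bounded P meps a mk kB.
have mAs u : measurable_fun setT (fun x : R => avg P eps a k (x + u)).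
  by have := measurable_fun_affine 1 u mA; under eq_fun do rewrite mul1r.
have iA u : mu.-integrable setT (EFin \o (fun x => k x * avg P eps a k (x + u))).
  by apply: (integrableM_bounded ik (mAs u)) => x; exact: bA.
have i1 := integrable_funB measurableT (iA (y + s + t)) (iA (y + s)).
have i2 := integrable_funB measurableT i1 (iA (y + t)).
rewrite !avg_autocorr -RintegralB// -RintegralB// -RintegralD//.
rewrite (_ : \int[mu]_x _ = \int[mu]_x (k x * (avg P eps a k (x + (y + s + t)) -
  avg P eps a k (x + (y + s)) - avg P eps a k (x + (y + t)) +
  avg P eps a k (x + y)))); last first.
  by apply: eq_Rintegral => x _; ring.
rewrite (_ : _ * `|s| * `|t| = (M * \int[mu]_x `|k x| / `|a| ^+ 3 * `|s| * `|t|) *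
  \int[mu]_x `|k x|); last by ring.
apply: (RintegralM_bounded ik).
  exact: (measurable_funD (measurable_funB (measurable_funB (mAs _) (mAs _)) (mAs _)) (mAs _)).
move=> x; have := sdiff2_avg_kernel a0 (x + y) s t.
by rewrite !addrA.
Qed.

End smoothing.

(** * The integrated variance as a double sum of covariances *)

Section integrated_variance.
Context {R : realType} d (T : measurableType d) (P : probability T R).
Local Notation mu := (@lebesgue_measure R).
Variables (X : nat -> T -> R) (f : R -> R).
Hypothesis mX : forall n, measurable_fun setT (X n).
Hypothesis dX : forall n, has_density P (X n) f.
Variables (k : R -> R) (Bk : R).
Hypothesis ik : mu.-integrable setT (EFin \o k).
Hypothesis kB : forall x, `|k x| <= Bk.
Hypothesis mG : measurable_fun setT (autocorr k).

Let mk : measurable_fun setT k := measurable_fun_integrable ik.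
Let BG := Bk * \int[mu]_x `|k x|.
Let GB y : `|autocorr k y| <= BG := autocorr_bounded ik kB y.

(** For the scaled kernel this is the mean of the density estimator at [x], all observations having
    the same law. *)
Definition kmean (x : R) : R := \int[P]_t k (x - X 0 t).

Lemma X_identically_distributed (i : nat) (phi : R -> R) (B : R) :
  measurable_fun setT phi -> (forall x, `|phi x| <= B) ->
  \int[P]_t phi (X i t) = \int[P]_t phi (X 0 t).
Proof.
by move=> mphi phiB; rewrite !(Rintegral_has_density (mX _) (dX _) mphi phiB).
Qed.

Let mkX : measurable_fun setT (fun z : R * T => k (z.1 - X 0 z.2)).
Proof.
apply: measurableT_comp => //; apply: measurable_funB => //.
exact: measurableT_comp.
Qed.

Lemma measurable_kmean : measurable_fun setT kmean.
Proof. exact: (measurable_expectation P mkX (fun z => kB _)). Qed.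

Lemma kmean_bounded (x : R) : `|kmean x| <= Bk.
Proof.
apply: normr_expectation_le => //.
exact: (measurableT_comp mkX (measurable_pair1 x)).
Qed.

(** In the other order of integration the inner integral is the mass of [k], by translation
    invariance. *)
Lemma integrable_kmean : mu.-integrable setT (EFin \o kmean).
Proof.
pose F (z : measurableTypeR R * T) := (k (z.1 - X 0 z.2))%:E.
have mF : measurable_fun setT F by apply/measurable_EFinP; exact: mkX.
have Flty : (\int[P]_t \int[mu]_x `|F (x, t)| < +oo)%E.
  rewrite (eq_integral (fun=> \int[mu]_x (`|k x|)%:E)%E); last first.
    move=> t _; rewrite /F /=.
    rewrite (@ge0_integral_affine _ (fun x => `|k x|) 1 (- X 0 t) (oner_neq0 R))//.
      by rewrite normr1 mul1e; apply: eq_integral => x _; rewrite mul1r.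
    exact: measurableT_comp.
  have [_ kfin] := integrableP _ _ _ ik.
  by rewrite integral_cst// [X in (_ * X)%E]probability_setT mule1.
have := integrable_fubini_F ((integrable21ltyP mu P mF).2 Flty).
apply: eq_integrable => // x _; rewrite /fubini_F /F /= /kmean fineK//.
apply: integrable_fin_num => //; apply: (bounded_integrable Bk) => //.
exact: (measurableT_comp mkX (measurable_pair1 x)).
Qed.

Let im := integrable_kmean.
Let iks u : mu.-integrable setT (EFin \o (fun x => k (x - u))) :=
  integrable_kernel_shift ik (- u).

(** The cross term in the expansion of the squared deviation from the mean. *)
Definition kcross (u : R) : R := \int[mu]_x (k (x - u) * kmean x).

Lemma kcrossE (u : R) : kcross u = \int[P]_t autocorr k (u - X 0 t).
Proof.
rewrite /kcross (Fubini_bounded P (iks u) mkX (fun z => kB _)).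
by apply: eq_Rintegral => t _; rewrite -(Rintegral_kernelM ik kB).
Qed.

Let mGX : measurable_fun setT (fun z : R * T => autocorr k (z.1 - X 0 z.2)).
Proof.
apply: measurableT_comp => //; apply: measurable_funB => //.
exact: measurableT_comp.
Qed.

Lemma measurable_kcross : measurable_fun setT kcross.
Proof.
rewrite (_ : kcross = fun u => \int[P]_t autocorr k (u - X 0 t)); last first.
  by apply/funext => u; exact: kcrossE.
exact: (measurable_expectation P mGX (fun z => GB _)).
Qed.

Lemma kcross_bounded (u : R) : `|kcross u| <= BG.
Proof.
rewrite kcrossE; apply: normr_expectation_le => //.
exact: (measurableT_comp mGX (measurable_pair1 u)).
Qed.

Lemma kmean_sqE : \int[mu]_x (kmean x * kmean x) = \int[P]_t kcross (X 0 t).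
Proof.
rewrite {2}/kmean (Fubini_bounded P im mkX (fun z => kB _)).
by apply: eq_Rintegral => t _; apply: eq_Rintegral => x _; rewrite mulrC.
Qed.

(** The choice of [i] and [j] is free, so that each pair of observations can be compared with its
    own independent version. *)
Lemma kmean_sq_decoupled (i j : nat) :
  \int[mu]_x (kmean x * kmean x) =
  \int[P]_t \int[P]_s autocorr k (X i t - X j s).
Proof.
rewrite kmean_sqE -(X_identically_distributed i measurable_kcross kcross_bounded).
apply: eq_Rintegral => t _; rewrite kcrossE.
rewrite (X_identically_distributed j (phi := fun x => autocorr k (X i t - x)) (B := BG))//.
by apply: measurableT_comp => //; exact: measurable_funB.
Qed.

Let imm : mu.-integrable setT (EFin \o (fun x => kmean x * kmean x)) :=
  integrableM_bounded im measurable_kmean kmean_bounded.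
Let ikm u : mu.-integrable setT (EFin \o (fun x => k (x - u) * kmean x)) :=
  integrableM_bounded (iks u) measurable_kmean kmean_bounded.
Let ikk u v : mu.-integrable setT (EFin \o (fun x => k (x - u) * k (x - v))) :=
  integrable_kernelM ik kB (- u) (- v).

Let prodE (u v : R) : (fun x => (k (x - u) - kmean x) * (k (x - v) - kmean x)) =
  (fun x => (k (x - u) * k (x - v) - k (x - u) * kmean x - k (x - v) * kmean x)
            + kmean x * kmean x).
Proof. by apply/funext => x; ring. Qed.

Let i1 u v := integrable_funB measurableT (ikk u v) (ikm u).
Let i2 u v := integrable_funB measurableT (i1 u v) (ikm v).
Let i3 u v := integrable_funD measurableT (i2 u v) imm.

Lemma Rintegral_centred_kernelM (u v : R) :
  \int[mu]_x ((k (x - u) - kmean x) * (k (x - v) - kmean x)) =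
  autocorr k (u - v) - kcross u - kcross v + \int[mu]_x (kmean x * kmean x).
Proof.
rewrite prodE (RintegralD measurableT (i2 u v) imm).
rewrite (RintegralB measurableT (i1 u v) (ikm v)).
by rewrite (RintegralB measurableT (ikk u v) (ikm u)) (Rintegral_kernelM ik kB).
Qed.

Let prod_integrable (u v : R) : mu.-integrable setT
  (EFin \o (fun x => (k (x - u) - kmean x) * (k (x - v) - kmean x))).
Proof. by rewrite prodE; exact: i3. Qed.

(** The deviation is taken from the mean and not from the density, which leaves the bias apart. *)
Definition ise (n : nat) (t : T) : R :=
  \int[mu]_x ((n%:R^-1 * \sum_(1 <= i < n.+1) k (x - X i t)) - kmean x) ^+ 2.

Let centred (n : nat) (t : T) : (0 < n)%N ->
  (fun x => ((n%:R^-1 * \sum_(1 <= i < n.+1) k (x - X i t)) - kmean x) ^+ 2) =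
  (fun x => n%:R^-2 * \sum_(1 <= i < n.+1) \sum_(1 <= j < n.+1)
    ((k (x - X i t) - kmean x) * (k (x - X j t) - kmean x))).
Proof.
move=> n0; apply/funext => x.
have n1 : n%:R != 0 :> R by rewrite pnatr_eq0 -lt0n.
have -> : n%:R^-1 * \sum_(1 <= i < n.+1) k (x - X i t) - kmean x =
    n%:R^-1 * \sum_(1 <= i < n.+1) (k (x - X i t) - kmean x).
  rewrite sumrB sumr_const_nat subn1 /= mulrBr.
  by congr (_ - _); rewrite -[kmean x *+ n]mulr_natl mulrA mulVf// mul1r.
by rewrite exprMn exprVn [X in _ * X]expr2 big_distrlr.
Qed.

Lemma integrable_ise (n : nat) (t : T) : (0 < n)%N -> mu.-integrable setT
  (EFin \o (fun x => ((n%:R^-1 * \sum_(1 <= i < n.+1) k (x - X i t)) - kmean x) ^+ 2)).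
Proof.
move=> n0; rewrite centred//; apply: integrable_funZ => //.
by apply: integrable_fun_sum => // i; exact: integrable_fun_sum.
Qed.

Lemma iseE (n : nat) : (0 < n)%N ->
  ise n = fun t => n%:R^-2 * \sum_(1 <= i < n.+1) \sum_(1 <= j < n.+1)
    (autocorr k (X i t - X j t) - kcross (X i t) - kcross (X j t) +
     \int[mu]_x (kmean x * kmean x)).
Proof.
move=> n0; apply/funext => t; rewrite /ise centred// RintegralZl//; last first.
  by apply: integrable_fun_sum => // i; exact: integrable_fun_sum.
congr (_ * _); rewrite Rintegral_sum//; last first.
  by move=> i; exact: integrable_fun_sum.
apply: eq_bigr => i _; rewrite Rintegral_sum//.
by apply: eq_bigr => j _; rewrite Rintegral_centred_kernelM.
Qed.

Let imG i j : P.-integrable setT (EFin \o (fun t => autocorr k (X i t - X j t))).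
Proof.
apply: (bounded_integrable BG) => //; apply: measurableT_comp => //.
exact: measurable_funB.
Qed.

Let imD i : P.-integrable setT (EFin \o (fun t => kcross (X i t))).
Proof.
apply: (bounded_integrable BG); last by move=> t; exact: kcross_bounded.
exact: (measurableT_comp measurable_kcross).
Qed.

Lemma integrable_ise_sample (n : nat) : (0 < n)%N ->
  P.-integrable setT (EFin \o ise n).
Proof.
move=> n0; rewrite iseE//; apply: integrable_funZ => //.
apply: integrable_fun_sum => // i; apply: integrable_fun_sum => // j.
by solve_integrable.
Qed.

(** Each of the two cross terms has the same mean as the constant term, so a single negative copy of
    the latter remains. *)
Lemma mean_ise (n : nat) : (0 < n)%N ->
  \int[P]_t ise n t = n%:R^-2 * \sum_(1 <= i < n.+1) \sum_(1 <= j < n.+1)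
    (\int[P]_t autocorr k (X i t - X j t) - \int[mu]_x (kmean x * kmean x)).
Proof.
move=> n0; set g := \int[mu]_x _.
have ED i : \int[P]_t kcross (X i t) = g.
  by rewrite /g kmean_sqE (X_identically_distributed i measurable_kcross kcross_bounded).
have Ecst : \int[P]__ g = g.
  by rewrite Rintegral_cst// [X in fine X]probability_setT mulr1.
rewrite iseE// RintegralZl//; last first.
  apply: integrable_fun_sum => // i; apply: integrable_fun_sum => // j.
  by solve_integrable.
congr (_ * _); rewrite Rintegral_sum//; last first.
  by move=> i; apply: integrable_fun_sum => // j; solve_integrable.
apply: eq_bigr => i _; rewrite Rintegral_sum//; last first.
  by move=> j; solve_integrable.
apply: eq_bigr => j _.
rewrite RintegralD//; [|by solve_integrable..].
rewrite RintegralB//; [|by solve_integrable..].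
by rewrite RintegralB// !ED Ecst subrK.
Qed.

End integrated_variance.

(** * Summability of the covariances *)

Section covariance_bound.
Context {R : realType} d (T : measurableType d) (P : probability T R).
Variables (eps : int -> T -> R) (feps : R -> R).
Hypothesis meps : forall i, measurable_fun setT (eps i).
Hypothesis ieps : mutual_indep P eps.
Hypothesis deps : forall i, has_density P (eps i) feps.
Hypothesis i2eps : P.-integrable setT (fun t => (eps 0 t ^+ 2)%:E).
Variables (a : nat -> R) (X : nat -> T -> R).
Hypothesis mX : forall n, measurable_fun setT (X n).
Hypothesis aX : forall n, {ae P, forall t,
  series (fun i => a i * eps (n%:Z - i%:Z) t) @ \oo --> X n t}.
Hypothesis ca : cvgn (series (fun i => `|a i|)).
Variables (G : R -> R) (B M : R) (m0 : nat).
Hypothesis cG : continuous G.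
Hypothesis GB : forall x, `|G x| <= B.
Hypothesis M0 : 0 <= M.
Hypothesis am0 : forall l, (l < m0)%N -> a l = 0.
Hypothesis GM : sdiff2 M (avg P eps (a m0) G).

Let S (n N : nat) (t : T) : R := series (fun i => a i * eps (n%:Z - i%:Z) t) N.
Let sig := \int[P]_t (eps 0 t ^+ 2).
(** Truncated autocorrelation, at lag [k], of the absolute coefficients. *)
Let r (k N : nat) : R := \sum_(0 <= l < N) `|a l| * `|a (l + k)%N|.

Let mG : measurable_fun setT G := continuous_measurable_fun cG.

Let mS n N : measurable_fun setT (S n N).
Proof.
by apply: measurable_sum => i; exact: measurable_funM.
Qed.

(** With [i - j + N] terms for [X_i] and [N] for [X_j] both truncated series stop at the same
    innovation, so they are linear forms over one list [J0]. *)
Lemma decoupling_truncated (i j N : nat) : (j < i)%N -> (m0 < N)%N ->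
  `|\int[P]_t G (S i (i - j + N) t - S j N t) -
    \int[P]_t \int[P]_s G (S i (i - j + N) t - S j N s)| <=
  2 * M * sig * r (i - j) N.
Proof.
move=> ji m0N.
pose k := (i - j)%N; rewrite -/k.
pose q (l : nat) : int := i%:Z - l%:Z.
pose J0 := [seq q l | l <- iota 0 (k + N)].
pose al (p : int) := a `|i%:Z - p|%N.
(* The absolute value is the lag behind [j] only when [p <= j]; later innovations do not enter
   [X_j]. *)
pose be (p : int) := if (p <= j%:Z)%R then a `|j%:Z - p|%N else 0.
have qinj : injective q by move=> x y /addrI /oppr_inj [].
have uJ0 : uniq J0 by rewrite map_inj_uniq ?iota_uniq.
pose i0 := q m0.
have i0J : i0 \in J0.
  by apply: map_f; rewrite mem_iota /= add0n (leq_trans m0N)// leq_addl.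
have pJ := perm_to_rem i0J.
have uJ : uniq (i0 :: rem i0 J0) by rewrite -(perm_uniq pJ).
have alq l : al (q l) = a l.
  by rewrite /al /q opprB addrCA subrr addr0.
have beq l : be (q (k + l)%N) = a l.
  rewrite /be /q.
  have -> : i%:Z - (k + l)%N%:Z = j%:Z - l%:Z.
    by rewrite /k PoszD -subzn 1?ltnW//; ring.
  by rewrite lerBlDr lerDl /= opprB addrCA subrr addr0.
have beq0 l : (l < k)%N -> be (q l) = 0.
  move=> lk; rewrite /be /q; case: ifPn => //.
  by rewrite lerBlDr -PoszD lez_nat => H; move: lk; rewrite /k ltn_subRL ltnNge H.
have qj l : q (k + l)%N = j%:Z - l%:Z.
  by rewrite /q /k PoszD -subzn 1?ltnW//; ring.
have LFa t : linear_form eps al (i0 :: rem i0 J0) t = S i (k + N) t.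
  rewrite /linear_form -(perm_big _ pJ) /= /J0 big_map /S /series /= /index_iota subn0.
  by apply: eq_bigr => l _; rewrite alq.
have LFb t : linear_form eps be (i0 :: rem i0 J0) t = S j N t.
  rewrite /linear_form -(perm_big _ pJ) /= /J0 big_map iotaD big_cat /=.
  rewrite big_seq big1 ?add0r; last first.
    by move=> l; rewrite mem_iota /= add0n => lk; rewrite beq0// mul0r.
  rewrite add0n -[in X in iota X N](addn0 k) iotaDl big_map /S /series /= /index_iota subn0.
  by apply: eq_bigr => l _; rewrite beq qj.
(* Seen from [X_j], innovation [i0] is either in the future or at lag [m0 - k < m0], where the
   coefficient vanishes. *)
have be0 : be i0 = 0.
  have [lk|kl] := ltnP m0 k; first exact: beq0.
  rewrite /i0 -(subnKC kl) beq am0//.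
  rewrite ltn_subrL lt0n subn_eq0 -ltnNge ji /=.
  by apply: leq_trans kl; rewrite /k subn_gt0.
have := @decoupling _ _ _ P eps feps meps ieps deps i2eps al be B M M0 i0 (rem i0 J0) G
  uJ mG GB be0.
rewrite /i0 alq -/i0 => /(_ GM).
under eq_Rintegral do rewrite LFa LFb.
under [X in _ - X]eq_Rintegral do under eq_Rintegral do rewrite LFa LFb.
move=> /le_trans; apply.
apply: ler_wpM2l.
  by rewrite !mulr_ge0// Rintegral_ge0// => t _; exact: sqr_ge0.
have -> : r k N = \sum_(p <- J0) `|al p| * `|be p|.
  rewrite /J0 big_map iotaD big_cat /=.
  rewrite [X in _ = X + _]big_seq big1 ?add0r; last first.
    by move=> l; rewrite mem_iota /= add0n => lk; rewrite beq0// normr0 mulr0.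
  rewrite add0n -[in X in iota X N](addn0 k) iotaDl big_map /r /index_iota subn0.
  by apply: eq_bigr => l _; rewrite alq beq mulrC addnC.
by rewrite (perm_big _ pJ) /= big_cons lerDr mulr_ge0.
Qed.

Let A := limn (series (fun i => `|a i|)).

Let partial_le N : \sum_(0 <= l < N) `|a l| <= A.
Proof.
apply: (@nondecreasing_cvgn_le _ (series (fun i => `|a i|))) => //.
by apply/nondecreasing_seqP => n; rewrite /series /= big_nat_recr //= lerDl.
Qed.

Let A0 : 0 <= A.
Proof. by apply: le_trans (partial_le 0); rewrite big_nil. Qed.

(** After exchanging the sums, the lags attached to a fixed [l] run over distinct coefficients and
    contribute at most [A], uniformly in [n] and [N]. *)
Let r_bound (n N : nat) : \sum_(1 <= k < n) r k N <= A * A.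
Proof.
rewrite exchange_big /=.
apply: (@le_trans _ _ (\sum_(0 <= l < N) `|a l| * A)); last first.
  by rewrite -mulr_suml ler_wpM2r.
apply: ler_sum => l _; rewrite -mulr_sumr ler_wpM2l//.
apply: le_trans (partial_le (l + n)%N).
have [n1|n1] := leqP n 1; first by rewrite big_geq// sumr_ge0.
have ln : (l + 1 <= l + n)%N by rewrite leq_add2l ltnW.
rewrite [X in _ <= X](big_cat_nat (leq0n _) ln) /=.
rewrite [X in _ <= _ + X](_ : _ = \sum_(1 <= k < n) `|a (l + k)%N|); last first.
  by rewrite addnC big_addn addnC addnK; apply: eq_bigr => k _; rewrite addnC.
by rewrite lerDr sumr_ge0.
Qed.

Let r_cvg k : cvgn (r k).
Proof.
apply: nondecreasing_is_cvgn.
  by apply/nondecreasing_seqP => n; rewrite /r big_nat_recr //= lerDl mulr_ge0.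
exists (A * A) => _ [N _ <-].
apply: (@le_trans _ _ (\sum_(0 <= l < N) `|a l| * A)).
  apply: ler_sum => l _; rewrite ler_wpM2l//.
  by apply: le_trans (partial_le (l + k).+1); rewrite big_nat_recr //= lerDr sumr_ge0.
by rewrite -mulr_suml ler_wpM2r.
Qed.

Let Rk k := limn (r k).

Let Rk_sum n : \sum_(1 <= k < n) Rk k <= A * A.
Proof.
have H : (fun N => \sum_(1 <= k < n) r k N) @ \oo --> \sum_(1 <= k < n) Rk k.
  elim: (index_iota 1 n) => [|k s IH].
    by under eq_fun do rewrite big_nil; rewrite big_nil; exact: cvg_cst.
  under eq_fun do rewrite big_cons; rewrite big_cons.
  by apply: cvgD => //; exact: r_cvg.
rewrite -(cvg_lim _ H)//; apply: limr_le; first by apply/cvg_ex; eexists; exact: H.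
by apply: nearW => N; exact: r_bound.
Qed.

(** The truncated bound passes to the limit by continuity and boundedness of [G]; in the decoupled
    expectation bounded convergence is applied to each of the two integrals. *)
Lemma covariance_le (i j : nat) : (j < i)%N ->
  `|\int[P]_t G (X i t - X j t) - \int[P]_t \int[P]_s G (X i t - X j s)| <=
  2 * M * sig * Rk (i - j).
Proof.
move=> ji; pose k := (i - j)%N; rewrite -/k.
have cSk t : (fun N => S i N t) @ \oo --> X i t ->
    (fun N => S i (k + N) t) @ \oo --> X i t.
  move=> H; apply: (cvg_comp _ _ _ H).
  exact: cvg_addnl.
have c1 : (fun N => \int[P]_t G (S i (k + N) t - S j N t)) @ \oo -->
    \int[P]_t G (X i t - X j t).
  apply: (bounded_convergence (B := B)) => //.
  - by move=> N; apply: measurableT_comp => //; exact: measurable_funB.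
  - by apply: measurableT_comp => //; exact: measurable_funB.
  - apply: filterS2 (aX i) (aX j) => t Xi Xj.
    apply: continuous_cvg; first exact: cG.
    by apply: cvgB => //; exact: cSk.
have c2 : (fun N => \int[P]_t \int[P]_s G (S i (k + N) t - S j N s)) @ \oo -->
    \int[P]_t \int[P]_s G (X i t - X j s).
  have mpair (U V : T -> R) : measurable_fun setT U -> measurable_fun setT V ->
      measurable_fun setT (fun z : T * T => G (U z.1 - V z.2)).
    move=> mU mV; apply: measurableT_comp => //.
    by apply: measurable_funB; exact: measurableT_comp.
  have mone (U : R) (V : T -> R) : measurable_fun setT V ->
      measurable_fun setT (fun s => G (U - V s)).
    by move=> mV; apply: measurableT_comp => //; exact: measurable_funB.
  apply: (bounded_convergence (B := B)).
  - by move=> N; apply: (measurable_expectation P (mpair _ _ (mS _ _) (mS _ _)) (fun z => GB _)).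
  - exact: (measurable_expectation P (mpair _ _ (mX _) (mX _)) (fun z => GB _)).
  - apply: filterS (aX i) => t Xi.
    apply: (bounded_convergence (B := B)) => //.
    + by move=> N; exact: mone.
    + exact: mone.
    + apply: filterS (aX j) => s Xj.
      apply: continuous_cvg; first exact: cG.
      by apply: cvgB => //; exact: cSk.
  - by move=> N t; apply: normr_expectation_le => //; exact: mone.
have c3 : (fun N => `|\int[P]_t G (S i (k + N) t - S j N t) -
      \int[P]_t \int[P]_s G (S i (k + N) t - S j N s)|) @ \oo -->
    `|\int[P]_t G (X i t - X j t) - \int[P]_t \int[P]_s G (X i t - X j s)|.
  by apply: cvg_norm; exact: cvgB.
rewrite -(cvg_lim _ c3)//; apply: limr_le; first by apply/cvg_ex; eexists; exact: c3.
near=> N.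
apply: (@le_trans _ _ (2 * M * sig * r k N)).
  by apply: decoupling_truncated => //; near: N; exact: nbhs_infty_gt.
apply: ler_wpM2l.
  by rewrite !mulr_ge0// Rintegral_ge0// => t _; exact: sqr_ge0.
apply: (@nondecreasing_cvgn_le _ (r k)) => //.
by apply/nondecreasing_seqP => n; rewrite /r big_nat_recr //= lerDl mulr_ge0.
Unshelve. all: by end_near. Qed.

(** In each row the diagonal entry is at most [G 0], since [g] is nonnegative, and the lags on
    either side of it cost at most [2 M sig A^2]. Evenness of [G] makes the matrix symmetric. *)
Lemma covariance_sum_le (n : nat) (g : R) : (forall y, G (- y) = G y) -> 0 <= g ->
  (forall i j, \int[P]_t \int[P]_s G (X i t - X j s) = g) ->
  \sum_(1 <= i < n.+1) \sum_(1 <= j < n.+1) (\int[P]_t G (X i t - X j t) - g) <=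
  n%:R * (G 0 + 4 * M * sig * (A * A)).
Proof.
move=> Gev g0 gE.
pose c i j := \int[P]_t G (X i t - X j t) - g.
have csym i j : c i j = c j i.
  by rewrite /c; congr (_ - _); apply: eq_Rintegral => t _; rewrite -Gev opprB.
have sig0 : 0 <= sig by rewrite Rintegral_ge0// => t _; exact: sqr_ge0.
have clt i j : (j < i)%N -> c i j <= 2 * M * sig * Rk (i - j).
  by move=> ji; apply: le_trans (ler_norm _) _; rewrite /c -(gE i j); exact: covariance_le.
have cii i : c i i <= G 0.
  rewrite /c; under eq_Rintegral do rewrite subrr.
  by rewrite Rintegral_cst// [X in fine X]probability_setT mulr1 gerBl.
have row i : (1 <= i < n.+1)%N ->
    \sum_(1 <= j < n.+1) c i j <= G 0 + 4 * M * sig * (A * A).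
  move=> /andP[i1 iN].
  rewrite (big_cat_nat i1 (ltnW iN)) /= [X in _ + X]big_ltn//.
  have H1 : \sum_(1 <= j < i) c i j <= 2 * M * sig * (A * A).
    apply: (@le_trans _ _ (\sum_(1 <= j < i) 2 * M * sig * Rk (i - j))).
      by rewrite big_nat [leRHS]big_nat; apply: ler_sum => j /andP[_ ji]; exact: clt.
    rewrite -mulr_sumr ler_wpM2l ?mulr_ge0//; apply: le_trans (Rk_sum i).
    rewrite big_nat_rev /= big_nat [leRHS]big_nat; apply: ler_sum => j /andP[j1 ji].
    by rewrite add1n subSS subKn// ltnW.
  have H2 : \sum_(i.+1 <= j < n.+1) c i j <= 2 * M * sig * (A * A).
    apply: (@le_trans _ _ (\sum_(i.+1 <= j < n.+1) 2 * M * sig * Rk (j - i))).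
      rewrite big_nat [leRHS]big_nat; apply: ler_sum => j /andP[ij _].
      by rewrite csym; exact: clt.
    rewrite -mulr_sumr ler_wpM2l ?mulr_ge0//; apply: le_trans (Rk_sum (n.+1 - i)).
    rewrite -add1n big_addn; apply: ler_sum => j _; by rewrite addnK.
  have := cii i; lra.
rewrite big_nat; apply: (@le_trans _ _ (\sum_(1 <= i < n.+1 | (1 <= i < n.+1)%N)
    (G 0 + 4 * M * sig * (A * A)))).
  by apply: ler_sum => i; exact: row.
by rewrite -big_nat sumr_const_nat subn1 /= [X in _ <= X]mulr_natl lexx.
Qed.

End covariance_bound.

(** * Increments of [x ln x] *)

Section xlnx.
Context {R : realType}.

Lemma ln_le_sub1 (x : R) : 0 < x -> ln x <= x - 1.
Proof.
move=> x0; have := @le_ln1Dx _ (x - 1); rewrite [1 + _]addrC subrK; apply.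
by rewrite ltrBrDl subrr.
Qed.

(** The increment is [(u - w) ln u + w ln (u / w)], whose last term lies between 0 and [u - w]
    because [ln x <= x - 1]. The value [w = 0] is treated apart. *)
Lemma xlnx_dist_le (u w : R) : 0 < u -> 0 <= w -> w <= u ->
  (u - w) * ln u <= u * ln u - w * ln w /\
  u * ln u - w * ln w <= (u - w) * (1 + ln u).
Proof.
move=> u0; rewrite le_eqVlt => /predU1P[<- _|w0 wu].
  by rewrite !subr0 mul0r subr0 lexx mulrDr mulr1 lerDr ltW.
have lwu : ln w <= ln u by rewrite ler_ln.
have H : ln (u / w) <= u / w - 1 by apply: ln_le_sub1; rewrite divr_gt0.
have : w * ln (u / w) <= u - w.
  have := ler_wpM2l (ltW w0) H; rewrite mulrBr mulr1 mulrCA divff ?gt_eqF// mulr1.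
  by [].
rewrite ln_div ?posrE// mulrBr => H2.
have := ler_wpM2l (ltW w0) lwu; split; lra.
Qed.

Lemma normr_ln_le (z lo hi : R) : 0 < lo -> lo <= z -> z <= hi ->
  `|ln z| <= `|ln lo| + `|ln hi|.
Proof.
move=> lo0 loz zhi; have z0 := lt_le_trans lo0 loz.
have H1 : ln lo <= ln z by rewrite ler_ln.
have H2 : ln z <= ln hi by rewrite ler_ln// posrE (lt_le_trans z0).
have := ler_norm (ln hi); have := lerNnormlW (lexx `|ln lo|).
have := normr_ge0 (ln lo); have := normr_ge0 (ln hi).
by rewrite ler_norml => *; apply/andP; split; lra.
Qed.

(** The slope is governed by the logarithm of the larger argument alone. Hence [gam] has to bound
    only [u] from below, and [w], the true density, may vanish. *)
Lemma xlnx_lipschitz (u w gam M : R) : 0 < gam -> gam <= u -> 0 <= w ->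
  u <= M -> w <= M ->
  `|u * ln u - w * ln w| <= `|u - w| * (1 + `|ln gam| + `|ln M|).
Proof.
move=> gam0 gu w0 uM wM; have u0 := lt_le_trans gam0 gu.
have key (p q : R) : gam <= p -> p <= M -> 0 <= q -> q <= p ->
    `|p * ln p - q * ln q| <= (p - q) * (1 + `|ln gam| + `|ln M|).
  move=> gp pM q0 qp.
  have [H1 H2] := xlnx_dist_le (lt_le_trans gam0 gp) q0 qp.
  have H3 := normr_ln_le gam0 gp pM.
  have pq : 0 <= p - q by rewrite subr_ge0.
  move: H3; rewrite !ler_norml => /andP[H3 H4].
  have H5 := ler_wpM2l pq H3; have H6 := ler_wpM2l pq H4.
  by apply/andP; split; lra.
have [wu|/ltW uw] := leP w u.
  by rewrite (ger0_norm (x := u - w)) ?subr_ge0//; exact: key.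
rewrite distrC (distrC u) (ger0_norm (x := w - u)) ?subr_ge0//.
by apply: key => //; [exact: le_trans uw|exact: ltW].
Qed.

(* Beyond [M >= e] the logarithm is no longer controlled by [gam]; there the error is
   dominated both by [u ln Bu] and by the squared deviation of [u] from its mean. *)
Lemma xlnx_large (u w M Bu mu0 : R) : expR 1 <= M -> M < u -> u <= Bu ->
  0 <= w -> w <= M -> `|mu0| <= M / 2 ->
  `|u * ln u - w * ln w| <= Num.min (2 * ln Bu * `|u|) (8 * (u - mu0) ^+ 2).
Proof.
move=> eM Mu uBu w0 wM mM.
have M0 : 0 < M by exact: lt_le_trans (expR_gt0 1) eM.
have u0 : 0 < u by exact: lt_trans Mu.
have wu : w <= u by exact: le_trans (ltW Mu).
have lnu1 : 1 <= ln u.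
  by rewrite -(expRK 1) ler_ln ?posrE ?expR_gt0// (le_trans eM)// ltW.
have lnuu : ln u <= u by apply: (le_trans (ln_le_sub1 u0)); rewrite gerBl.
have lnuB : ln u <= ln Bu by rewrite ler_ln// posrE (lt_le_trans u0).
have [H1 H2] := xlnx_dist_le u0 w0 wu.
have pos : 0 <= u * ln u - w * ln w.
  by apply: le_trans H1; rewrite mulr_ge0 ?subr_ge0// (le_trans ler01).
(* [M >= e] yields [ln u >= 1], so that [1 + ln u <= 2 ln u]. *)
have H3 : u * ln u - w * ln w <= 2 * (u * ln u).
  apply: (le_trans H2); rewrite mulrDr mulr1; have := ler_wpM2l (ltW u0) lnu1.
  have : w * ln u >= 0 by rewrite mulr_ge0// (le_trans ler01).
  lra.
rewrite ger0_norm// le_min; apply/andP; split.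
  rewrite ger0_norm ?(ltW u0)//; apply: (le_trans H3).
  have := ler_wpM2l (ltW u0) lnuB; lra.
apply: (le_trans H3).
have := ler_wpM2l (ltW u0) lnuu.
move: mM; rewrite ler_norml => /andP[_ mM].
(* [mu0 <= M / 2 < u / 2], hence [2 u ln u <= 2 u^2 <= 8 (u - mu0)^2]. *)
have : u / 2 <= u - mu0 by lra.
have u20 : 0 <= u / 2 by rewrite divr_ge0 ?ltW.
move=> H; have := ler_pM u20 u20 H H; rewrite expr2; nra.
Qed.

End xlnx.

(** * The entropy error for a fixed sample point *)

Section entropy_error.
Context {R : realType}.
Local Notation mu := (@lebesgue_measure R).
Variables (u m f : R -> R) (gam M Bu bet kap : R).
Hypothesis iu : mu.-integrable setT (EFin \o u).
Hypothesis im : mu.-integrable setT (EFin \o m).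
Hypothesis iv : mu.-integrable setT (EFin \o (fun x => (u x - m x) ^+ 2)).
Hypothesis ifl : mu.-integrable setT (EFin \o (fun x => f x * ln (f x))).
Hypothesis f0 : forall x, 0 <= f x.
Hypothesis fM : forall x, f x <= M.
Hypothesis mM : forall x, `|m x| <= M / 2.
Hypothesis mf : forall x, `|m x - f x| <= bet.
Hypothesis uB : forall x, u x <= Bu.
Hypothesis ukap : \int[mu]_x `|u x| <= kap.
Hypothesis kap0 : 0 < kap.
Hypothesis gam0 : 0 < gam.
Hypothesis eM : expR 1 <= M.
Hypothesis MBu : M <= Bu.

Let A : set R := [set x | 0 < gam <= u x].
Let V := \int[mu]_x (u x - m x) ^+ 2.
Let L := 1 + `|ln gam| + `|ln M|.

Let mu_ : measurable_fun setT u := measurable_fun_integrable iu.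
Let mm_ : measurable_fun setT m := measurable_fun_integrable im.

Let AE x : A x -> gam <= u x. Proof. by move=> /andP[]. Qed.

Let mA : measurable A.
Proof.
rewrite (_ : A = setT `&` u @^-1` `[gam, +oo[).
  exact: mu_.
apply/seteqP; split => x; rewrite /A /= in_itv /= andbT gam0 //=.
by move=> [].
Qed.

Let sub (g : R -> R) : mu.-integrable setT (EFin \o g) -> mu.-integrable A (EFin \o g).
Proof. by apply: integrableS. Qed.

Let le_sub (g : R -> R) : mu.-integrable setT (EFin \o g) -> (forall x, 0 <= g x) ->
  \int[mu]_(x in A) g x <= \int[mu]_x g x.
Proof.
move=> ig g0; rewrite Rintegral_mkcond; apply: le_Rintegral => //.
  by rewrite -restrict_EFin -integrable_mkcond//; exact: sub.
by move=> x _; rewrite patchE; case: ifP.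
Qed.

Let iabs : mu.-integrable setT (EFin \o (fun x => `|u x|)) := integrable_norm iu.

Let le_integrableA (g : R -> R) (c : R) : measurable_fun setT g ->
  (forall x, A x -> `|g x| <= c * `|u x|) -> mu.-integrable A (EFin \o g).
Proof.
move=> mg gc; apply: (@le_integrable _ _ _ mu A mA _ (EFin \o (fun x => c * `|u x|))).
- by apply/measurable_EFinP/measurable_funTS; exact: mg.
- by move=> x Ax /=; rewrite lee_fin (le_trans (gc x Ax))// ler_norm.
- by apply: integrable_funZ => //; exact: sub.
Qed.

Let icst (c : R) : mu.-integrable A (EFin \o cst c).
Proof.
apply: (@le_integrableA _ (`|c| / gam)) => // x Ax /=.
rewrite mulrAC ler_pdivlMr// ler_wpM2l//.
by apply: le_trans (ler_norm _); exact: AE.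
Qed.

(** Markov's inequality in integrated form: [1 <= |u| / gam] on [A], whose measure is thus at most
    [kap / gam]. *)
Let int_cst (c : R) : 0 <= c -> \int[mu]_(x in A) c <= c * (kap / gam).
Proof.
move=> c0; apply: (@le_trans _ _ (\int[mu]_(x in A) ((c / gam) * `|u x|))).
  apply: le_Rintegral => //; [exact: icst|by apply: integrable_funZ => //; exact: sub|].
  move=> x Ax; rewrite mulrAC ler_pdivlMr// ler_wpM2l//.
  by apply: le_trans (ler_norm _); exact: AE.
rewrite RintegralZl//; last exact: sub.
rewrite (_ : c * (kap / gam) = c / gam * kap); last by ring.
by rewrite ler_wpM2l ?divr_ge0 ?(ltW gam0)//; apply: le_trans ukap; exact: le_sub.
Qed.

Let iabsv : mu.-integrable setT (EFin \o (fun x => `|u x - m x|)).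
Proof. by apply: (@integrable_norm _ _ _ mu setT (fun x => u x - m x)); exact: integrable_funB. Qed.

(** Integrating [2 l |v| <= l^2 + v^2] over [A] and optimising in [l]. *)
Let cauchy_schwarz : (\int[mu]_(x in A) `|u x - m x|) ^+ 2 <= (kap / gam) * V.
Proof.
set a := \int[mu]_(x in A) _.
have kg : 0 < kap / gam by rewrite divr_gt0.
have H (l : R) : 2 * l * a <= l ^+ 2 * (kap / gam) + V.
  apply: (@le_trans _ _ (\int[mu]_(x in A) (l ^+ 2 + (u x - m x) ^+ 2))).
    rewrite -RintegralZl//; last exact: sub.
    apply: le_Rintegral => //.
    - by apply: integrable_funZ => //; exact: sub.
    - by apply: integrable_funD => //; [exact: icst|exact: sub].
    - move=> x _; rewrite -(real_normK (num_real (u x - m x))).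
      have := sqr_ge0 (l - `|u x - m x|); rewrite sqrrB; lra.
  rewrite RintegralD//; [|exact: icst|exact: sub].
  apply: lerD; first by apply: int_cst; exact: sqr_ge0.
  by apply: le_sub => // x; exact: sqr_ge0.
(* The optimal [l] is the average of [|u - m|] with respect to the bound [kap / gam] on the measure
   of [A]. *)
have := H (a / (kap / gam)); set kg' := kap / gam.
rewrite (_ : 2 * (a / kg') * a = 2 * (a ^+ 2 / kg')); last by ring.
rewrite (_ : (a / kg') ^+ 2 * kg' = a ^+ 2 / kg'); last by field; rewrite gt_eqF.
move=> H2; have : a ^+ 2 / kg' <= V by lra.
by rewrite ler_pdivrMr// mulrC.
Qed.

Let mv : measurable_fun setT (fun x => (u x - m x) ^+ 2).
Proof. exact: measurable_fun_integrable iv. Qed.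

Let W (x : R) := Num.min (2 * ln Bu * `|u x|) (8 * (u x - m x) ^+ 2).

Let lnBu0 : 0 <= ln Bu.
Proof.
rewrite ln_ge0// (le_trans _ MBu)// (le_trans _ eM)//.
by have := expR_ge1Dx (1 : R); lra.
Qed.

Let W0 x : 0 <= W x.
Proof.
rewrite /W le_min; apply/andP; split; first by rewrite !mulr_ge0.
by rewrite mulr_ge0// sqr_ge0.
Qed.

Let iW : mu.-integrable A (EFin \o W).
Proof.
apply: (@le_integrableA _ (2 * ln Bu)).
  apply: measurable_minr.
    by apply: measurable_funM => //; exact: measurableT_comp.
  exact: measurable_funM.
by move=> x _; rewrite ger0_norm// /W ge_min lexx.
Qed.

(** The integral is at most [2 ln Bu kap] and at most [8 V]. Multiplying the two bounds keeps the
    square linear in [V], so that the mean of [V] suffices later; squaring the second would call for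
    fourth moments. *)
Let intW : (\int[mu]_(x in A) W x) ^+ 2 <= 16 * ln Bu * kap * V.
Proof.
set w := \int[mu]_(x in A) _.
have w0 : 0 <= w by apply: Rintegral_ge0 => x _; exact: W0.
have H1 : w <= 2 * ln Bu * kap.
  apply: (@le_trans _ _ (\int[mu]_(x in A) (2 * ln Bu * `|u x|))).
    apply: le_Rintegral => //; first by apply: integrable_funZ => //; exact: sub.
    by move=> x _; rewrite /W ge_min lexx.
  rewrite RintegralZl//; last exact: sub.
  rewrite ler_wpM2l ?mulr_ge0//; apply: le_trans ukap; exact: le_sub.
have H2 : w <= 8 * V.
  apply: (@le_trans _ _ (\int[mu]_(x in A) (8 * (u x - m x) ^+ 2))).
    apply: le_Rintegral => //; first by apply: integrable_funZ => //; exact: sub.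
    by move=> x _; rewrite /W ge_min lexx orbT.
  rewrite RintegralZl//; last exact: sub.
  by rewrite ler_wpM2l//; apply: le_sub => // x; exact: sqr_ge0.
have := ler_pM w0 w0 H1 H2; rewrite expr2; lra.
Qed.

(** Here [u], [m] and [f] are the estimator, its mean and the density, [bet] bounds the bias and
    [kap] the mass of [|u|]. The error is dominated by [L (|u - m| + bet)] where [u <= M], and by
    [W] elsewhere. *)
Lemma entropy_error_sq :
  (\int[mu]_(x in A) (u x * ln (u x)) - \int[mu]_(x in A) (f x * ln (f x))) ^+ 2 <=
  3 * (L ^+ 2 * (kap / gam) + 16 * ln Bu * kap) * V +
  3 * L ^+ 2 * (bet * (kap / gam)) ^+ 2.
Proof.
have bet0 : 0 <= bet by apply: le_trans (mf 0).
have L0 : 0 <= L by rewrite /L !addr_ge0.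
have iul : mu.-integrable A (EFin \o (fun x => u x * ln (u x))).
  apply: (@le_integrableA _ (`|ln gam| + `|ln Bu|)).
    by apply: measurable_funM => //; apply: measurableT_comp.
  move=> x Ax; rewrite normrM mulrC ler_wpM2r//.
  by apply: normr_ln_le => //; exact: AE.
have iVL : mu.-integrable A (EFin \o (fun x => L * (`|u x - m x| + bet))).
  apply: integrable_funZ => //; apply: integrable_funD => //; first exact: sub.
  exact: icst.
have bound : `|\int[mu]_(x in A) (u x * ln (u x)) - \int[mu]_(x in A) (f x * ln (f x))|
    <= \int[mu]_(x in A) (L * (`|u x - m x| + bet) + W x).
  rewrite -RintegralB//; last exact: sub.
  apply: normr_Rintegral_dominated => //.
  - by apply: integrable_funB => //; exact: sub.
  - by apply: integrable_funD.
  - move=> x Ax; have [uM|Mu] := leP (u x) M.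
      apply: (le_trans (xlnx_lipschitz gam0 (AE Ax) (f0 x) uM (fM x))).
      rewrite mulrC -[leLHS]addr0; apply: lerD => //.
      apply: ler_wpM2l => //; rewrite -(subrK (m x) (u x)) -addrA.
      by rewrite [in leRHS]subrK; apply: (le_trans (ler_normD _ _)); rewrite lerD2l.
    apply: (le_trans (xlnx_large eM Mu (uB x) (f0 x) (fM x) (mM x))).
    by rewrite lerDr mulr_ge0// addr_ge0.
rewrite RintegralD// RintegralZl// in bound; last first.
  by apply: integrable_funD => //; [exact: sub|exact: icst].
rewrite RintegralD// in bound; [|exact: sub|exact: icst].
have CS := cauchy_schwarz; have IW := intW; have IC := int_cst bet0.
have IC0 : 0 <= \int[mu]_(x in A) bet by exact: Rintegral_ge0.
have IC2 : (\int[mu]_(x in A) bet) ^+ 2 <= (bet * (kap / gam)) ^+ 2.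
  by rewrite ler_sqr ?nnegrE// (le_trans IC0).
rewrite -(real_normK (num_real (_ - _))).
set y := `|_| in bound *; set a := \int[mu]_(x in A) `|_| in bound CS *.
set b := \int[mu]_(x in A) bet in bound IC2 *; set w := \int[mu]_(x in A) _ in bound IW *.
have y0 : 0 <= y by exact: normr_ge0.
(* The square of a sum of three terms is at most three times the sum of their squares. *)
apply: (@le_trans _ _ (3 * ((L * a) ^+ 2 + (L * b) ^+ 2 + w ^+ 2))).
  have : y ^+ 2 <= (L * a + L * b + w) ^+ 2.
    by rewrite ler_sqr ?nnegrE -?mulrDr// (le_trans y0).
  move=> /le_trans; apply.
  have := sqr_ge0 (L * a - L * b); have := sqr_ge0 (L * b - w).
  have := sqr_ge0 (L * a - w); nra.
rewrite !exprMn.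
have L20 : 0 <= L ^+ 2 by exact: sqr_ge0.
have := ler_wpM2l L20 CS; have := ler_wpM2l L20 IC2; lra.
Qed.

End entropy_error.

(** * The bias of the kernel estimator *)

Section bias.
Context {R : realType}.
Local Notation mu := (@lebesgue_measure R).
Variables (f : R -> R) (M : R).
Hypothesis df : forall x, derivable f x 1.
Hypothesis ddf : forall x, derivable (derive1 f) x 1.
Hypothesis fM : forall x, `|derive1n 2 f x| <= M.

(** The mean value theorem followed by the Lipschitz bound on the derivative; the factor 1/2 of
    Taylor's formula is given up. *)
Lemma taylor1_le (x s : R) :
  `|f (x + s) - f x - s * derive1 f x| <= M * s ^+ 2.
Proof.
have M0 : 0 <= M by apply: le_trans (fM 0).
have dfd (z : R) := @derivable_is_derive R f z (@df z).
have cf (i : interval R) : {within [set` i], continuous f}.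
  by apply: derivable_within_continuous => z _; exact: df.
have Lip := lipschitz_is_derive (fun z => @derivable_is_derive R _ z (@ddf z)) fM.
have key (c : R) : `|c - x| <= `|s| -> f (x + s) - f x = s * derive1 f c ->
    `|f (x + s) - f x - s * derive1 f x| <= M * s ^+ 2.
  move=> cx ->; rewrite -mulrBr normrM -(real_normK (num_real s)) expr2 mulrCA.
  by apply: ler_wpM2l => //; apply: (le_trans (Lip x c)); rewrite ler_wpM2l.
have [s0|/ltW s0] := leP 0 s.
- have xs : x <= x + s by rewrite lerDl.
  have [c] := MVT_segment xs (fun z _ => dfd z) (cf `[x, x + s]).
  rewrite in_itv /= => /andP[c1 c2] E; apply: (key c).
    by rewrite !ger0_norm ?subr_ge0// lerBlDr addrC.
  by rewrite E mulrC; congr (_ * _); rewrite addrC addKr.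
- have xs : x + s <= x by rewrite gerDl.
  have [c] := MVT_segment xs (fun z _ => dfd z) (cf `[x + s, x]).
  rewrite in_itv /= => /andP[c1 c2] E; apply: (key c).
    by rewrite !ler0_norm ?subr_le0//; lra.
  by rewrite -opprB E; ring.
Qed.

(* On the side of [x] where [f] starts non-decreasing, [f >= f x - M] on a unit
   interval, whose mass is at most 1. *)
Lemma density_le : mu.-integrable setT (EFin \o f) -> (forall x, 0 <= f x) ->
  \int[mu]_x f x = 1 -> forall x, f x <= 1 + M.
Proof.
move=> fi f0 f1 x.
have key (l r : R) : l <= r -> r - l = 1 ->
    (forall z, l <= z <= r -> f x - M <= f z) -> f x <= 1 + M.
  move=> lr rl H; rewrite -lerBlDr -f1.
  have mI : measurable (`[l, r]%classic : set R) by [].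
  have iI : mu.-integrable `[l, r] (EFin \o f) by exact: (integrableS measurableT).
  have muI : mu `[l, r] = 1%E.
    rewrite lebesgue_measure_itv /= lte_fin; case: ltgtP lr => // [lr _|lr _].
      by rewrite -EFinB rl.
    by move: rl; rewrite lr subrr => /eqP; rewrite eq_sym oner_eq0.
  apply: (@le_trans _ _ (\int[mu]_(z in `[l, r]) f z)).
    rewrite -[leLHS]mulr1 -[X in _ * X]/(fine 1%E) -muI -Rintegral_cst//.
    apply: le_Rintegral => //.
    apply/integrableP; split; first exact/measurable_EFinP.
    rewrite /= integral_cst// [X in (_ * X)%E]muI mule1; exact: ltry.
  rewrite Rintegral_mkcond; apply: le_Rintegral => //.
    by rewrite -restrict_EFin -integrable_mkcond.
  by move=> z _; rewrite patchE; case: ifP.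
have M0 : 0 <= M by apply: le_trans (fM 0).
have low (z : R) : `|z - x| <= 1 -> 0 <= (z - x) * derive1 f x -> f x - M <= f z.
  move=> zx pos; have := taylor1_le x (z - x); rewrite [x + _]addrC subrK ler_norml => /andP[H _].
  have : (z - x) ^+ 2 <= 1 by rewrite -(real_normK (num_real (z - x))) expr_le1.
  move=> /(ler_wpM2l M0); lra.
have [d0|/ltW d0] := leP 0 (derive1 f x).
- apply: (key x (x + 1)); [lra|lra|move=> z /andP[z1 z2]; apply: low].
    by rewrite ger0_norm ?subr_ge0//; lra.
  by rewrite mulr_ge0 ?subr_ge0.
- apply: (key (x - 1) x); [lra|lra|move=> z /andP[z1 z2]; apply: low].
    by rewrite ler0_norm ?subr_le0//; lra.
  by rewrite mulr_le0 ?subr_le0.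
Qed.

Variables (K : R -> R) (BK Bs h : R).
Hypothesis iK : mu.-integrable setT (EFin \o K).
Hypothesis K1 : \int[mu]_u K u = 1.
Hypothesis KB : forall u, `|K u| <= BK.
Hypothesis Ksupp : forall u, Bs < `|u| -> K u = 0.
Hypothesis K0 : \int[mu]_u (u * K u) = 0.
Hypothesis h0 : 0 < h.

(* The summand [0] puts the argument in the form expected by [Rintegral_affine]. *)
Definition scaled_kernel (x : R) : R := h^-1 * K (h^-1 * x + 0).

Lemma scaled_kernel_bounded (x : R) : `|scaled_kernel x| <= BK / h.
Proof.
have hV : 0 <= h^-1 by rewrite invr_ge0 ltW.
by rewrite normrM mulrC (ger0_norm hV) ler_wpM2r.
Qed.

Let hV0 : h^-1 != 0. Proof. by rewrite invr_eq0 gt_eqF. Qed.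

Lemma integrable_scaled_kernel : mu.-integrable setT (EFin \o scaled_kernel).
Proof. by apply: integrable_funZ => //; exact: (integrable_affine 0 hV0 iK). Qed.

(** Invariance of the mass under scaling is what makes the covariance bound uniform in the
    bandwidth. *)
Lemma Rintegral_norm_scaled_kernel :
  \int[mu]_x `|scaled_kernel x| = \int[mu]_x `|K x|.
Proof.
rewrite [RHS](Rintegral_affine 0 hV0 (integrable_norm iK)).
rewrite -RintegralZl//; last exact: (integrable_norm (integrable_affine 0 hV0 iK)).
by apply: eq_Rintegral => x _; rewrite normrM.
Qed.

(** After the substitution [z = x - h y] the vanishing first moment of [K] allows the term
    [h y f'(x)] to be added at no cost. A second-order Taylor remainder is left, with [|y|] bounded
    on the support of [K]. *)
Lemma bias_le d (T : measurableType d) (P : probability T R) (X : nat -> T -> R) :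
  measurable_fun setT (X 0) -> has_density P (X 0) f -> forall x,
  `|kmean P X scaled_kernel x - f x| <=
  M * Num.max Bs 0 ^+ 2 * h ^+ 2 * \int[mu]_x `|K x|.
Proof.
(* The radius [Bs] may be negative; the maximum with 0 can be squared monotonically. *)
move=> mX dX x; set B := Num.max Bs 0.
have B0 : 0 <= B by rewrite le_max lexx orbT.
have M0 : 0 <= M by apply: le_trans (fM 0).
have mK := measurable_fun_integrable iK.
have [f0 mf _] := dX.
have fi := has_density_integrable dX.
have fle := density_le fi f0 (has_density_Rintegral dX).
have fB z : `|f z| <= 1 + M by rewrite ger0_norm.
have mk := measurable_fun_integrable integrable_scaled_kernel.
have mkx : measurable_fun setT (fun z : R => scaled_kernel (x - z)).
  by apply: measurableT_comp => //; exact: measurable_funB.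
rewrite /kmean (Rintegral_has_density mX dX mkx (fun z => scaled_kernel_bounded _)).
have ikf : mu.-integrable setT (EFin \o (fun z => scaled_kernel (x - z) * f z)).
  have := integrableM_bounded fi mkx (fun z => scaled_kernel_bounded (x - z)).
  by under eq_fun do rewrite mulrC.
have hn0 : - h != 0 by rewrite oppr_eq0 gt_eqF.
rewrite (Rintegral_affine x hn0 ikf).
have mfx : measurable_fun setT (fun y : R => f (- h * y + x)).
  exact: measurable_fun_affine.
have iKf : mu.-integrable setT (EFin \o (fun y => K y * f (- h * y + x))).
  by apply: (integrableM_bounded iK mfx) => y; exact: fB.
have isk : mu.-integrable setT
    (EFin \o (fun y => scaled_kernel (x - (- h * y + x)) * f (- h * y + x))).
  exact: (integrable_affine x hn0 ikf).
rewrite (_ : `|- h| * _ = \int[mu]_y (K y * f (- h * y + x))); last first.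
  rewrite -RintegralZl//; apply: eq_Rintegral => y _; rewrite normrN gtr0_norm// /scaled_kernel.
  rewrite (_ : h^-1 * (x - (- h * y + x)) + 0 = y); last by field; rewrite gt_eqF.
  by rewrite mulrA mulrA divff ?gt_eqF// mul1r.
have iyK : mu.-integrable setT (EFin \o (fun y => y * K y)).
  apply: (@le_integrable _ _ _ mu _ measurableT _ (EFin \o (fun y => B * `|K y|))).
  - by apply/measurable_EFinP; exact: (measurable_funM _ mK).
  - move=> y _ /=; rewrite lee_fin [leRHS]ger0_norm ?mulr_ge0// normrM.
    have [yB|By] := leP `|y| Bs; last by rewrite Ksupp// normr0 !mulr0.
    by rewrite ler_wpM2r// /B le_max yB.
  - by apply: integrable_funZ => //; exact: (integrable_norm iK).
have ifK : mu.-integrable setT (EFin \o (fun y => f x * K y)) by exact: integrable_funZ.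
have ihK : mu.-integrable setT (EFin \o (fun y => h * derive1 f x * (y * K y))).
  exact: integrable_funZ.
have ikr := integrable_funD measurableT (integrable_funB measurableT iKf ifK) ihK.
have -> : \int[mu]_y (K y * f (- h * y + x)) - f x =
    \int[mu]_y (K y * f (- h * y + x) - f x * K y + h * derive1 f x * (y * K y)).
  rewrite RintegralD//; last exact: integrable_funB.
  by rewrite RintegralB// !RintegralZl// K1 K0 mulr1 mulr0 addr0.
have inK := integrable_norm iK.
rewrite -RintegralZl//; apply: normr_Rintegral_dominated => //.
  exact: integrable_funZ.
move=> y _.
have [yB|By] := leP `|y| Bs; last by rewrite Ksupp// normr0 !(mul0r, mulr0) subr0 addr0 normr0.
rewrite (_ : _ + _ = K y * (f (x + - h * y) - f x - (- h * y) * derive1 f x)); last first.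
  by rewrite (addrC x); ring.
rewrite normrM mulrC ler_wpM2r//; apply: (le_trans (taylor1_le _ _)).
rewrite -mulrA ler_wpM2l// exprMn sqrrN mulrC ler_wpM2r ?sqr_ge0//.
rewrite -(real_normK (num_real y)) ler_sqr ?nnegrE//.
by rewrite /B le_max yB.
Qed.

End bias.

(** * Extended limits and the L2 norm *)

Section extended_limits.
Context {R : realType}.
Local Open Scope ereal_scope.

Lemma near_le_limn_esup (u : nat -> \bar R) (q : \bar R) :
  (\forall n \near \oo, u n <= q) -> limn_esup u <= q.
Proof.
move=> uq; rewrite /limn_esup /limf_esup.
apply: (@le_trans _ _ (ereal_sup (u @` [set n | u n <= q]))).
  by apply: ereal_inf_lbound; exists [set n | u n <= q].
by apply: ge_ereal_sup => _ [n /= unq <-].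
Qed.

Lemma limn_esup_lty_near (u : nat -> R) : limn_esup (fun n => (u n)%:E) < +oo ->
  exists C : R, \forall n \near \oo, (u n <= C)%R.
Proof.
rewrite /limn_esup /limf_esup => /ereal_inf_lt[_ [V nV <-]] ltV.
have ub n : V n -> (u n)%:E <= ereal_sup ((fun n => (u n)%:E) @` V).
  by move=> Vn; apply: ereal_sup_ubound; exists n.
move: ltV ub; case: ereal_sup => [s| |] // _ ub.
  by exists s; apply: filterS nV => n /ub; rewrite lee_fin.
(* A supremum equal to [-oo] means that [V] is empty, so any constant will do. *)
by exists 0%R; apply: filterS nV => n /ub; rewrite leeNy_eq.
Qed.

Lemma limn_einf_gt0_near (u : nat -> R) : 0 < limn_einf (fun n => (u n)%:E) ->
  exists2 c : R, (0 < c)%R & \forall n \near \oo, (c <= u n)%R.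
Proof.
rewrite /limn_einf lteNr oppe0 /limn_esup /limf_esup => /ereal_inf_lt[_ [V nV <-]] ltV.
have ub n : V n -> - (u n)%:E <= ereal_sup ((fun n => - (u n)%:E) @` V).
  by move=> Vn; apply: ereal_sup_ubound; exists n.
move: ltV ub; case: ereal_sup => [s| |] // sn ub.
  exists (- s)%R; first by rewrite oppr_gt0 -lte_fin.
  by apply: filterS nV => n /ub; rewrite -EFinN lee_fin lerNl.
by exists 1%R => //; apply: filterS nV => n /ub; rewrite leeNy_eq.
Qed.

(** The integral of a nonnegative function is a supremum over the simple functions below it, hence
    monotone for arbitrary functions. This spares establishing that the entropy error is measurable
    in the sample point. *)
Lemma ge0_le_integral_nonmeasurable d (T : measurableType d)
    (mu : {measure set T -> \bar R}) (f1 f2 : T -> \bar R) :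
  (forall x, 0 <= f1 x) -> (forall x, f1 x <= f2 x) ->
  \int[mu]_x f1 x <= \int[mu]_x f2 x.
Proof.
move=> f10 f12; have f20 x : 0 <= f2 x by exact: le_trans (f12 x).
rewrite !ge0_integralTE//; apply: ereal_sup_le => _ [g /= gf <-].
by exists g => // x; exact: le_trans (f12 x).
Qed.

Lemma L2norm_le d (T : measurableType d) (P : probability T R) (Y Z : T -> R) (q : R) :
  P.-integrable setT (EFin \o Z) -> (forall t, Y t ^+ 2 <= Z t)%R ->
  (\int[P]_t Z t <= q)%R -> L2norm P Y <= (Num.sqrt q)%:E.
Proof.
move=> iZ YZ Zq.
have Ile : Lnorm P 2%:E (EFin \o Y) `^ 2 <= q%:E.
  rewrite poweR_Lnorm//.
  apply: (@le_trans _ _ (\int[P]_t (Z t)%:E)).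
    apply: ge0_le_integral_nonmeasurable => t; first exact: poweR_ge0.
    rewrite -[leLHS]/(`|Y t|%:E `^ 2) poweR_EFin lee_fin (powR_mulrn 2)//.
    by rewrite real_normK ?num_real.
  rewrite -[X in X <= _]fineK ?lee_fin//.
  by apply: integrable_fin_num.
have q0 : (0 <= q)%R by rewrite -lee_fin; apply: le_trans Ile; exact: poweR_ge0.
have NE : Lnorm P 2%:E (EFin \o Y) = (Lnorm P 2%:E (EFin \o Y) `^ 2) `^ 2^-1.
  by rewrite -poweRrM mulfV// poweRe1// Lnorm_ge0.
rewrite /L2norm NE.
rewrite -powR12_sqrt// -poweR_EFin; apply: gt0_ler_poweR => //.
- by rewrite in_itv /= leey andbT poweR_ge0.
- by rewrite in_itv /= leey andbT lee_fin.
Qed.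

End extended_limits.

(** * Bookkeeping of the rates *)

Section rates.
Context {R : realType}.

(** [|ln g| = ln (1 / g) <= 1 / g]: one factor [gam] absorbs one logarithmic slope [L]. *)
Lemma mul_normr_ln_le (g l : R) : 0 < g -> g <= 1 -> 0 <= l ->
  g * (1 + `|ln g| + l) <= 2 + l.
Proof.
move=> g0 g1 l0.
have lg : `|ln g| = ln g^-1 by rewrite lnV ?posrE// ler0_norm// ln_le0.
have : ln g^-1 <= g^-1.
  by apply: (le_trans (ln_le_sub1 _)); rewrite ?invr_gt0// gerBl.
rewrite -lg => /(ler_wpM2l (ltW g0)); rewrite divff ?gt_eqF// => H.
have : g * l <= l by rewrite ler_piMl.
by rewrite !mulrDr mulr1; lra.
Qed.

(** Since [rho^5 = ln n / n], the base is [(g / rho)^5]. *)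
Lemma powR_rate (n g : R) (rho := (ln n / n) `^ 5^-1) : 0 < n -> 0 < ln n -> 0 < g ->
  (n * g ^+ 5 / ln n) `^ (2 / 5) = (g / rho) ^+ 2.
Proof.
move=> n0 l0 g0.
have r0 : 0 < rho by rewrite powR_gt0// divr_gt0.
have r5 : rho ^+ 5 = ln n / n.
  by rewrite -powR_mulrn ?ltW// -powRrM mulVf// powRr1// divr_ge0 ?ltW.
have -> : n * g ^+ 5 / ln n = (g / rho) `^ 5.
  rewrite powR_mulrn ?divr_ge0 ?ltW// exprMn exprVn r5; field.
  by rewrite !gt_eqF.
rewrite -powRrM (_ : 5 * (2 / 5) = 2); last by field.
by rewrite powR_mulrn// divr_ge0 ?ltW.
Qed.

Lemma rate_bound (n h gam bet EV lnBu kap c C C4 C5 C6 lM : R)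
    (rho := (ln n / n) `^ 5^-1) (L := 1 + `|ln gam| + lM) :
  0 < n -> 1 <= ln n -> 0 < gam -> gam <= 1 -> 0 < c -> c * rho <= h -> h <= C * rho ->
  0 <= kap -> 0 <= lM -> 0 <= C4 -> 0 <= C5 -> 0 <= C6 ->
  0 <= EV -> EV <= C4 / (h * n) -> 0 <= lnBu -> lnBu <= C5 * ln n ->
  0 <= bet -> bet <= C6 * h ^+ 2 ->
  ((gam / rho) ^+ 2) ^+ 2 *
    (3 * (L ^+ 2 * (kap / gam) + 16 * lnBu * kap) * EV +
     3 * L ^+ 2 * (bet * (kap / gam)) ^+ 2) <=
  3 * kap * (2 + lM) ^+ 2 * (C4 / c) + 48 * kap * C5 * (C4 / c) +
  3 * kap ^+ 2 * (2 + lM) ^+ 2 * (C6 * C ^+ 2) ^+ 2.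
Proof.
move=> n0 l1 g0 g1 c0 crh hCr k0 lM0 C40 C50 C60 EV0 EVle lB0 lBle b0 ble.
have l0 : 0 < ln n by exact: lt_le_trans ltr01 l1.
have r0 : 0 < rho by rewrite powR_gt0// divr_gt0.
have r5 : rho ^+ 5 * n = ln n.
  rewrite -powR_mulrn ?ltW// -powRrM mulVf// powRr1 ?divr_ge0 ?ltW//.
  by rewrite divfK// gt_eqF.
have h0 : 0 < h by apply: lt_le_trans crh; rewrite mulr_gt0.
have hn0 : 0 < h * n by rewrite mulr_gt0.
(* Each [L] is paired with one [gam], the variance with [rho^4] and the bias with [rho^2]; the
   resulting [g], [e] and [b] are all bounded. *)
set g := gam * L; set e := EV / rho ^+ 4; set b := bet / rho ^+ 2.
have rn0 : rho != 0 by rewrite gt_eqF.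
have gn0 : gam != 0 by rewrite gt_eqF.
rewrite (_ : _ * _ = 3 * kap * gam * g ^+ 2 * e + 48 * gam ^+ 4 * kap * lnBu * e +
  3 * kap ^+ 2 * g ^+ 2 * b ^+ 2); last by rewrite /g /e /b; field; rewrite rn0.
have L0 : 0 <= L by rewrite /L !addr_ge0.
have gg : 0 <= g by rewrite mulr_ge0// ltW.
have gle : g <= 2 + lM by exact: mul_normr_ln_le.
have g2 : g ^+ 2 <= (2 + lM) ^+ 2 by rewrite ler_sqr ?nnegrE// addr_ge0.
have e0 : 0 <= e by rewrite divr_ge0// exprn_ge0// ltW.
(* [rho^5 n = ln n] and [h >= c rho] leave a spare [ln n] in the variance, which pays for [lnBu]
   below. *)
have elnn : e * ln n <= C4 / c.
  rewrite /e -r5 ler_pdivlMr//.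
  have -> : EV / rho ^+ 4 * (rho ^+ 5 * n) * c = EV * (n * (c * rho)).
    by field.
  apply: (@le_trans _ _ (EV * (n * h))).
    by rewrite ler_wpM2l// ler_wpM2l// ltW.
  by move: EVle; rewrite ler_pdivlMr// (mulrC h).
have ele : e <= C4 / c by apply: le_trans elnn; rewrite ler_peMr.
have ge0 := ltW g0.
have b20 : 0 <= b by rewrite divr_ge0// sqr_ge0.
have bC : b <= C6 * C ^+ 2.
  rewrite /b ler_pdivrMr ?exprn_gt0//; apply: (le_trans ble).
  rewrite -mulrA ler_wpM2l// -exprMn ler_sqr ?nnegrE ?(ltW h0)//.
  by rewrite (le_trans (ltW h0)).
have b2 : b ^+ 2 <= (C6 * C ^+ 2) ^+ 2 by rewrite ler_sqr ?nnegrE// (le_trans b20).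
apply: lerD; first apply: lerD.
- apply: ler_pM => //; first by rewrite !mulr_ge0// sqr_ge0.
  apply: ler_pM => //; [by rewrite !mulr_ge0|exact: sqr_ge0|].
  by rewrite ler_piMr// mulr_ge0.
- apply: (@le_trans _ _ (48 * kap * (lnBu * e))).
    rewrite (_ : 48 * gam ^+ 4 * kap * lnBu * e = gam ^+ 4 * (48 * kap * (lnBu * e))); last by ring.
    apply: ler_piMl; first by apply: mulr_ge0; exact: mulr_ge0.
    exact: exprn_ile1.
  rewrite -[leRHS]mulrA ler_wpM2l ?mulr_ge0//.
  apply: (@le_trans _ _ (C5 * ln n * e)); first by rewrite ler_wpM2r.
  by rewrite -mulrA ler_wpM2l// mulrC.
- apply: ler_pM => //; [by rewrite !mulr_ge0// sqr_ge0|exact: sqr_ge0|].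
  by rewrite ler_wpM2l// mulr_ge0// sqr_ge0.
Qed.

End rates.

(** * The L2 bound for a fixed sample size *)

Section fixed_sample_size.
Context {R : realType} d (T : measurableType d) (P : probability T R).
Local Notation mu := (@lebesgue_measure R).
Variables (eps : int -> T -> R) (feps : R -> R) (a : nat -> R) (X : nat -> T -> R)
  (f : R -> R) (K : R -> R) (h gam : nat -> R).
Hypothesis meps : forall i, measurable_fun setT (eps i).
Hypothesis ieps : mutual_indep P eps.
Hypothesis deps : forall i, has_density P (eps i) feps.
Hypothesis i2eps : P.-integrable setT (fun t => (eps 0 t ^+ 2)%:E).
Variables (Bf Me Mf BK Bs iota CK : R).
Hypothesis fepsB : forall x, `|feps x| <= Bf.
Hypothesis ca : cvgn (series (fun i => `|a i|)).
Variable m0 : nat.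
Hypothesis am0 : a m0 != 0.
Hypothesis al0 : forall l, (l < m0)%N -> a l = 0.
Hypothesis mX : forall n, measurable_fun setT (X n).
Hypothesis aX : forall n, {ae P, forall t,
  series (fun i => a i * eps (n%:Z - i%:Z) t) @ \oo --> X n t}.
Hypothesis dX : forall n, has_density P (X n) f.
Hypothesis ifl : mu.-integrable setT (EFin \o (fun x => f x * ln (f x))).
Hypothesis iK : mu.-integrable setT (EFin \o K).
Hypothesis K1 : \int[mu]_u K u = 1.
Hypothesis KB : forall u, `|K u| <= BK.
Hypothesis Ksupp : forall u, Bs < `|u| -> K u = 0.
Hypothesis iota0 : 0 < iota.
Hypothesis Khoelder : forall u v, `|K u - K v| <= CK * `|u - v| `^ iota.
Hypothesis K0 : \int[mu]_u (u * K u) = 0.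
Hypothesis dfeps : forall x, derivable feps x 1.
Hypothesis ddfeps : forall x, derivable (derive1 feps) x 1.
Hypothesis fepsM : forall x, `|derive1n 2 feps x| <= Me.
Hypothesis df : forall x, derivable f x 1.
Hypothesis ddf : forall x, derivable (derive1 f) x 1.
Hypothesis fM : forall x, `|derive1n 2 f x| <= Mf.
Variable n : nat.
Hypothesis n0 : (0 < n)%N.
Hypothesis h0 : 0 < h n.
Hypothesis h1 : h n <= 1.
Hypothesis gam0 : 0 < gam n.

Definition kernel_mass : R := \int[mu]_x `|K x|.
Definition bias_const : R := Mf * Num.max Bs 0 ^+ 2 * kernel_mass.
(** [1 + Mf] bounds the density and [bias_const] the bias when [h n <= 1]; doubling their sum keeps
    the mean of the estimator below half the level. The summand [expR 1] makes logarithms above the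
    level at least 1. *)
Definition level_const : R := expR 1 + 2 * (1 + Mf + bias_const).
(** The off-diagonal cost per row of the covariance matrix, free of the bandwidth. *)
Definition cov_const : R := 4 * (Me * kernel_mass ^+ 2 / `|a m0| ^+ 3) *
  (\int[P]_t (eps 0 t ^+ 2)) *
  (limn (series (fun i => `|a i|)) * limn (series (fun i => `|a i|))).

Let k : R -> R := scaled_kernel K (h n).
Let ik := integrable_scaled_kernel iK h0 : mu.-integrable setT (EFin \o k).
Let kB := scaled_kernel_bounded KB h0 : forall x, `|k x| <= BK / h n.
Let kap := kernel_mass.

Lemma kernel_mass_ge1 : 1 <= kernel_mass.
Proof.
rewrite -K1; apply: (le_trans (ler_norm _)).
exact: (le_normr_Rintegral measurableT iK).
Qed.

Let kap0 : 0 < kap := lt_le_trans ltr01 kernel_mass_ge1.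

Let cG : continuous (autocorr k).
Proof.
have hk u v : `|k u - k v| <= ((h n)^-1 * (CK * (h n)^-1 `^ iota)) * `|u - v| `^ iota.
  have hV : 0 <= (h n)^-1 by rewrite invr_ge0 ltW.
  rewrite /k /scaled_kernel -mulrBr normrM (ger0_norm hV).
  rewrite -mulrA ler_wpM2l//; apply: (le_trans (Khoelder _ _)).
  rewrite !addr0 -mulrBr normrM (ger0_norm hV).
  by rewrite powRM// mulrA.
exact: (hoelder_continuous iota0 (autocorr_hoelder ik kB hk)).
Qed.

Let mG : measurable_fun setT (autocorr k) := continuous_measurable_fun cG.

Let Me0 : 0 <= Me. Proof. exact: le_trans (fepsM 0). Qed.
Let Mf0 : 0 <= Mf. Proof. exact: le_trans (fM 0). Qed.
Let BK0 : 0 <= BK. Proof. exact: le_trans (KB 0). Qed.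

(** Only the diagonal feels the bandwidth, through the autocorrelation at 0, of order [1 / h n]. The
    dependence between observations adds a constant per row, so the rate is that of independent
    data. *)
Lemma mean_ise_le :
  \int[P]_t ise P X k n t <= (BK * kap / h n + cov_const) / n%:R.
Proof.
rewrite (mean_ise mX dX ik kB mG n0).
have sd := @sdiff2_derive1n _ feps Me dfeps ddfeps fepsM.
have GM := sdiff2_avg_autocorr meps deps fepsB sd ik kB am0.
have knorm : \int[mu]_x `|k x| = kap by exact: Rintegral_norm_scaled_kernel.
rewrite knorm in GM.
have M0 : 0 <= Me * kap ^+ 2 / `|a m0| ^+ 3.
  by apply: divr_ge0; [apply: mulr_ge0 => //; exact: sqr_ge0|exact: exprn_ge0].
have g0 : 0 <= \int[mu]_x (kmean P X k x * kmean P X k x).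
  by apply: Rintegral_ge0 => x _; rewrite -expr2 sqr_ge0.
have := @covariance_sum_le _ _ _ P eps feps meps ieps deps i2eps a X mX aX ca
  (autocorr k) _ _ m0 cG (autocorr_bounded ik kB) M0 al0 GM n _
  (autocorrN ik kB) g0 (fun i j => esym (kmean_sq_decoupled mX dX ik kB mG i j)).
have nn0 : 0 < n%:R :> R by rewrite ltr0n.
have nV0 : 0 <= n%:R ^- 2 :> R by rewrite invr_ge0 exprn_ge0// ltW.
move=> /(ler_wpM2l nV0) /le_trans; apply.
have E (Z : R) : n%:R ^- 2 * (n%:R * Z) = Z / n%:R by field; rewrite gt_eqF.
have nV : 0 <= n%:R^-1 :> R by rewrite invr_ge0 ltW.
rewrite E ler_wpM2r// /cov_const lerD2r.
apply: (le_trans (ler_norm _)); apply: (le_trans (autocorr_bounded ik kB 0)).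
by rewrite knorm mulrAC.
Qed.

Let kdeE t : kde K h X n t = fun x => n%:R^-1 * \sum_(1 <= i < n.+1) k (x - X i t).
Proof.
apply/funext => x; rewrite /kde invfM -mulrA mulr_sumr; congr (_ * _).
by apply: eq_bigr => i _; rewrite /k /scaled_kernel addr0; congr (_ * K _); rewrite mulrC.
Qed.

Let iku t i : mu.-integrable setT (EFin \o (fun x => k (x - X i t))) :=
  integrable_kernel_shift ik (- X i t).

Let integrable_kde t : mu.-integrable setT (EFin \o kde K h X n t).
Proof.
by rewrite kdeE; apply: integrable_funZ => //; exact: integrable_fun_sum.
Qed.

(** [K] may change sign, so the mass of [|f_n|] is compared with that of [|K|] rather than with
    1. *)
Let kde_mass t : \int[mu]_x `|kde K h X n t x| <= kap.
Proof.
have nn0 : 0 < n%:R :> R by rewrite ltr0n.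
have nV : 0 <= n%:R^-1 :> R by rewrite invr_ge0 ltW.
have ink i := integrable_norm (iku t i).
apply: (@le_trans _ _ (\int[mu]_x (n%:R^-1 * \sum_(1 <= i < n.+1) `|k (x - X i t)|))).
  apply: le_Rintegral => //.
  - exact: (integrable_norm (integrable_kde t)).
  - by apply: integrable_funZ => //; exact: integrable_fun_sum.
  - move=> x _; rewrite kdeE normrM (ger0_norm nV).
    by rewrite ler_wpM2l// ler_norm_sum.
rewrite RintegralZl//; last exact: integrable_fun_sum.
rewrite Rintegral_sum//.
rewrite (eq_bigr (fun=> kap)); last first.
  move=> i _; rewrite -[RHS](Rintegral_norm_scaled_kernel iK h0).
  exact: (Rintegral_kernel_shift (- X i t) (integrable_norm ik)).
by rewrite sumr_const_nat subn1 /= -[kap *+ n]mulr_natl mulrA mulVf ?gt_eqF// mul1r.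
Qed.

Let kde_le t x : kde K h X n t x <= BK / h n.
Proof.
have nn0 : 0 < n%:R :> R by rewrite ltr0n.
rewrite kdeE ler_pdivrMl//.
apply: (@le_trans _ _ (\sum_(1 <= i < n.+1) (BK / h n))).
  by apply: ler_sum => i _; apply: le_trans (ler_norm _) _; exact: kB.
by rewrite sumr_const_nat subn1 /= [X in _ <= X]mulr_natl lexx.
Qed.

(** For every sample point the squared error is at most [c1 * ise + c2] with deterministic [c1] and
    [c2], so that the mean of [ise] suffices. [Bu] is chosen above both the level and the supremum
    bound [BK / h n]. *)
Lemma entropy_error_L2 (Bu := level_const + BK / h n)
    (L := 1 + `|ln (gam n)| + `|ln level_const|) :
  (L2norm P (fun t => (entropy_est K h gam X n t - entropy_target K h gam X f n t)%R) <=
  (Num.sqrt (3 * (L ^+ 2 * (kap / gam n) + 16 * ln Bu * kap) *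
      ((BK * kap / h n + cov_const) / n%:R) +
    3 * L ^+ 2 * (bias_const * h n ^+ 2 * (kap / gam n)) ^+ 2))%:E)%E.
Proof.
have [f0 mf _] := dX 0.
have fi := has_density_integrable (dX 0).
have fle := density_le df ddf fM fi f0 (has_density_Rintegral (dX 0)).
have bias := bias_le df ddf fM iK K1 KB Ksupp K0 h0 (mX 0) (dX 0).
have biasE x : `|kmean P X k x - f x| <= bias_const * h n ^+ 2.
  apply: (le_trans (bias x)); rewrite /bias_const /kernel_mass.
  by rewrite [leRHS]mulrAC.
have B0 : 0 <= bias_const.
  by apply: mulr_ge0; [apply: mulr_ge0 => //; exact: sqr_ge0|exact: ltW].
have biasB x : `|kmean P X k x - f x| <= bias_const.
  apply: (le_trans (biasE x)); rewrite ler_piMr// exprn_ile1//.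
  exact: ltW.
have e1 : 0 < expR 1 :> R := expR_gt0 1.
have mM x : `|kmean P X k x| <= level_const / 2.
  rewrite -(subrK (f x) (kmean P X k x)); apply: (le_trans (ler_normD _ _)).
  have := biasB x; have := fle x; rewrite (ger0_norm (f0 x)) /level_const; lra.
have fL x : f x <= level_const by have := fle x; have := Mf0; rewrite /level_const; lra.
have eL : expR 1 <= level_const by have := Mf0; rewrite /level_const; lra.
have BKh : 0 <= BK / h n by rewrite divr_ge0// ltW.
have MBu : level_const <= Bu by rewrite /Bu lerDl.
have lnBu0 : 0 <= ln Bu.
  rewrite ln_ge0// (le_trans _ MBu)// (le_trans _ eL)//.
  by have := expR_ge1Dx (1 : R); lra.
have L20 : 0 <= L ^+ 2 by exact: sqr_ge0.
set c1 := 3 * (L ^+ 2 * (kap / gam n) + 16 * ln Bu * kap).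
set c2 := 3 * L ^+ 2 * _ ^+ 2.
have c10 : 0 <= c1.
  rewrite /c1 mulr_ge0// addr_ge0//; last by rewrite !mulr_ge0// ltW.
  by rewrite mulr_ge0// divr_ge0 ?ltW.
have iise := integrable_ise_sample P mX ik kB mG n0.
apply: (@L2norm_le _ _ _ _ _ (fun t => c1 * ise P X k n t + c2)).
- apply: integrable_funD => //; first exact: integrable_funZ.
  exact: finite_measure_integrable_cst.
- move=> t.
  have im := integrable_kmean P mX ik kB.
  have iv : mu.-integrable setT
      (EFin \o (fun x => (kde K h X n t x - kmean P X k x) ^+ 2)).
    by rewrite kdeE; exact: (integrable_ise P mX ik kB t n0).
  have uB x : kde K h X n t x <= Bu.
    by apply: (le_trans (kde_le t x)); rewrite /Bu lerDr (le_trans _ eL)// ltW.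
  have := entropy_error_sq (integrable_kde t) im iv ifl f0 fL mM biasE uB
    (kde_mass t) kap0 gam0 eL MBu.
  set A := [set x | _].
  have mA : measurable A.
    have mk := measurable_fun_integrable (integrable_kde t).
    rewrite (_ : A = setT `&` kde K h X n t @^-1` `[gam n, +oo[); first exact: mk.
    by apply/seteqP; split => x; rewrite /A /= in_itv /= andbT gam0 //= => -[].
  have iA : mu.-integrable A (EFin \o (fun x => f x * ln (f x))).
    exact: (integrableS measurableT).
  have -> : entropy_est K h gam X n t - entropy_target K h gam X f n t =
      - (\int[mu]_(x in A) (kde K h X n t x * ln (kde K h X n t x)) -
         \int[mu]_(x in A) (f x * ln (f x))).
    have tE : entropy_target K h gam X f n t = - \int[mu]_(x in A) (f x * ln (f x)).
      rewrite -mulN1r -RintegralZl//; apply: eq_Rintegral => x _.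
      by rewrite mulN1r mulNr mulrC.
    by rewrite tE opprK opprB addrC.
  rewrite sqrrN => /le_trans; apply.
  by rewrite (_ : \int[mu]_x _ = ise P X k n t)// kdeE.
- rewrite RintegralD//; [|exact: integrable_funZ|exact: finite_measure_integrable_cst].
  rewrite RintegralZl// Rintegral_cst// [X in fine X]probability_setT mulr1 lerD2r.
  by rewrite ler_wpM2l// mean_ise_le.
Qed.

End fixed_sample_size.

(** * Passage to large sample sizes *)

Theorem theorem2 (R : realType) (d : measure_display) (T : measurableType d)
  (P : probability T R)
  (eps : int -> T -> R) (feps : R -> R)
  (a : nat -> R) (X : nat -> T -> R) (f : R -> R)
  (K : R -> R) (h gam : nat -> R) :
  (* the innovations: iid, centred, finite variance, common bounded density *)
  (forall i, measurable_fun setT (eps i)) ->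
  mutual_indep P eps ->
  (forall i, has_density P (eps i) feps) ->
  (forall i, ('E_P[eps i] = 0)%E) ->
  (forall i, P.-integrable setT (fun t => (eps i t ^+ 2)%:E)) ->
  (exists M, forall x, `|feps x| <= M) ->
  (* coefficients *)
  cvgn (series (fun i => `|a i|)) ->
  limn (series a) != 0 ->
  (* the linear process X_n = sum_i a_i eps_{n-i} (a.s.), with marginal density f *)
  (forall n, measurable_fun setT (X n)) ->
  (forall n, {ae P, forall t,
     series (fun i => a i * eps (n%:Z - i%:Z) t) @ \oo --> X n t}) ->
  (forall n, has_density P (X n) f) ->
  (* S(f) finite *)
  lebesgue_measure.-integrable setT (fun x => (f x * ln (f x))%:E) ->
  (* kernel *)
  lebesgue_measure.-integrable setT (fun u => (K u)%:E) ->
  Rintegral lebesgue_measure setT K = 1 ->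
  (exists M, forall u, `|K u| <= M) ->
  (exists B, forall u, B < `|u| -> K u = 0) ->
  (exists iota C, [/\ 0 < iota, iota <= 1 &
     forall u v, `|K u - K v| <= C * `|u - v| `^ iota]) ->
  Rintegral lebesgue_measure setT (fun u => u * K u) = 0 ->
  (* bandwidths *)
  (forall n, 0 < h n) ->
  asymp h (fun n => (ln n%:R / n%:R) `^ (5^-1)) ->
  (* smoothness of the densities *)
  (forall x, derivable feps x 1) ->
  (forall x, derivable (derive1 feps) x 1) ->
  (exists M, forall x, `|(derive1 feps) x| <= M) ->
  (exists M, forall x, `|(derive1n 2 feps) x| <= M) ->
  lebesgue_measure.-integrable setT (fun x => (feps x ^+ 2)%:E) ->
  lebesgue_measure.-integrable setT (fun x => ((derive1 feps) x ^+ 2)%:E) ->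
  lebesgue_measure.-integrable setT (fun x => ((derive1n 2 feps) x ^+ 2)%:E) ->
  (forall x, derivable f x 1) ->
  (forall x, derivable (derive1 f) x 1) ->
  (exists M, forall x, `|(derive1n 2 f) x| <= M) ->
  (* truncation levels *)
  (forall n, 0 < gam n) ->
  gam @ \oo --> 0 ->
  h =o_\oo gam ->
  (limn_esup (fun n =>
     ((n%:R * gam n ^+ 5 / ln n%:R) `^ (2 / 5))%R%:E *
     L2norm P (fun t => (entropy_est K h gam X n t - entropy_target K h gam X f n t)%R))
   < +oo)%E.
Proof.
move=> meps ieps deps _ i2eps [Bf fepsB] ca sa0 mX aX dX ifl iK K1 [BK KB] [Bs Ksupp]
  [iota [CK [iota0 _ Khoelder]]] K0 h0 [hlo hup] dfeps ddfeps _ [Me fepsM] _ _ _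
  df ddf [Mf fM] gam0 gamc hgam.
(* A nonzero sum forces a nonzero coefficient; its least index marks the most recent innovation
   entering each [X_n]. *)
have [m0 am0 al0] : exists2 m0, a m0 != 0 & forall l, (l < m0)%N -> a l = 0.
  have exa : exists l, a l != 0.
    apply: contrapT => nex; move: sa0.
    have -> : series a = cst 0.
      apply/funext => N; rewrite /series /= big1// => l _.
      by apply/eqP; apply: contrapT => /negP al; apply: nex; exists l.
    by rewrite lim_cst// eqxx.
  case: (ex_minnP exa) => m0 am0 min; exists m0 => // l lm0.
  by apply/eqP; apply: contraTT lm0 => /min; rewrite -leqNgt.
have [c c0 clo] := limn_einf_gt0_near hlo.
have [C Cup] := limn_esup_lty_near hup.
set kap := kernel_mass K.
have kap1 : 1 <= kap by exact: kernel_mass_ge1.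
have kap0 : 0 <= kap by exact: le_trans kap1.
have Mf0 : 0 <= Mf by exact: le_trans (fM 0).
have Me0 : 0 <= Me by exact: le_trans (fepsM 0).
have BK0 : 0 <= BK by exact: le_trans (KB 0).
pose C6 := bias_const K Mf Bs; pose lev := level_const K Mf Bs.
pose cov := cov_const P eps a K Me m0.
have C60 : 0 <= C6 by apply: mulr_ge0 => //; apply: mulr_ge0 => //; exact: sqr_ge0.
have e1 : 1 <= expR 1 :> R by have := expR_ge1Dx (1 : R); lra.
have lev1 : 1 <= lev by rewrite /lev /level_const -/C6; lra.
have cov0 : 0 <= cov.
  apply: mulr_ge0; last by rewrite -expr2 sqr_ge0.
  apply: mulr_ge0; last by apply: Rintegral_ge0 => t _; exact: sqr_ge0.
  apply: mulr_ge0 => //; apply: divr_ge0; last exact: exprn_ge0.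
  by apply: mulr_ge0 => //; exact: sqr_ge0.
pose C4 := BK * kap + cov.
have C40 : 0 <= C4 by rewrite /C4 addr_ge0// mulr_ge0.
have BKc : 0 <= BK / c by rewrite divr_ge0// ltW.
(* For large [n] one has [Bu <= (lev + BK / c) n]; the summand 1 accounts for the factor [n], and
   [ln n >= 1] absorbs the constant. *)
pose C5 := ln (lev + BK / c) + 1.
have lev2 : 1 <= lev + BK / c by rewrite (le_trans lev1)// lerDl.
have C51 : 0 <= ln (lev + BK / c) by rewrite ln_ge0.
pose Q := 3 * kap * (2 + `|ln lev|) ^+ 2 * (C4 / c) + 48 * kap * C5 * (C4 / c) +
  3 * kap ^+ 2 * (2 + `|ln lev|) ^+ 2 * (C6 * C ^+ 2) ^+ 2.
apply: (@le_lt_trans _ _ (Num.sqrt Q)%:E); last by rewrite ltry.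
apply: near_le_limn_esup.
(* The conditions on [gam] enter as [h n <= gam n <= 1] for large [n]. *)
have hle : \forall n \near \oo, h n <= gam n.
  have /eqoP /(_ 1 ltr01) := hgam; apply: filterS => n /=.
  by rewrite mul1r !gtr0_norm.
have gle : \forall n \near \oo, gam n <= 1.
  have /cvgr_dist_lt /(_ _ ltr01) := gamc; apply: filterS => n.
  by rewrite sub0r normrN gtr0_norm// => /ltW.
near=> n.
(* This guarantees [ln n >= 1]. *)
have n_e : expR 1 <= n%:R :> R by near: n; exact: nbhs_infty_ger.
have nn0 : 0 < n%:R :> R by apply: lt_le_trans n_e; exact: expR_gt0.
have n0 : (0 < n)%N by rewrite -(ltr0n R).
have ln1 : 1 <= ln (n%:R : R).
  have : ln (expR 1) <= ln (n%:R : R) by rewrite ler_ln ?posrE ?expR_gt0.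
  by rewrite expRK.
have ln0 : 0 < ln (n%:R : R) by exact: lt_le_trans ltr01 ln1.
have hg : h n <= gam n by near: n.
have g1 : gam n <= 1 by near: n.
have h1 : h n <= 1 by exact: le_trans hg g1.
have crn : c <= h n / ((ln (n%:R : R) / n%:R) `^ 5^-1) by near: n.
have hrC : h n / ((ln (n%:R : R) / n%:R) `^ 5^-1) <= C by near: n.
set rho := (ln (n%:R : R) / n%:R) `^ 5^-1.
have r0 : 0 < rho by rewrite powR_gt0// divr_gt0.
have crh : c * rho <= h n by rewrite -ler_pdivlMr.
have hCr : h n <= C * rho by rewrite -ler_pdivrMr.
pose Bu := lev + BK / h n.
have lnBu0 : 0 <= ln Bu.
  by rewrite ln_ge0// (le_trans lev1)// lerDl divr_ge0// ltW.
have lnBu : ln Bu <= C5 * ln (n%:R : R).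
  have n1 : 1 <= n%:R :> R by rewrite ler1n.
  have r5 : rho ^+ 5 * n%:R = ln (n%:R : R).
    rewrite -powR_mulrn ?(ltW r0)// -powRrM mulVf// powRr1 ?divr_ge0 ?(ltW ln0)//.
    by rewrite divfK// gt_eqF.
  (* [(n rho)^5 = n^4 ln n >= 1]; with [h n >= c rho] this yields [1 / h n <= n / c]. *)
  have nr : 1 <= n%:R * rho.
    rewrite leNgt; apply/negP => H.
    have nr0 : 0 <= n%:R * rho by rewrite mulr_ge0// ltW.
    have : (n%:R * rho) ^+ 5 < 1 by rewrite exprn_ilt1.
    apply/negP; rewrite -leNgt exprMn.
    rewrite (_ : n%:R ^+ 5 * rho ^+ 5 = n%:R ^+ 4 * (rho ^+ 5 * n%:R)); last by ring.
    by rewrite r5 mulr_ege1// exprn_ege1.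
  have hn : BK / h n <= BK / c * n%:R.
    rewrite ler_pdivrMr// -mulrA -mulrA ler_peMr//.
    rewrite -mulrA ler_pdivlMl// mulr1; apply: le_trans (ler_wpM2l (ltW nn0) crh).
    rewrite mulrCA; apply: ler_peMr => //; exact: ltW.
  have BuN : Bu <= (lev + BK / c) * n%:R.
    rewrite mulrDl /Bu; apply: lerD => //.
    by rewrite ler_peMr// (le_trans ler01).
  have Bu0 : 0 < Bu by apply: lt_le_trans ltr01 _; rewrite (le_trans lev1)// lerDl divr_ge0// ltW.
  have lc0 : 0 < lev + BK / c by exact: lt_le_trans lev2.
  apply: (@le_trans _ _ (ln ((lev + BK / c) * n%:R))).
    by rewrite ler_ln ?posrE// mulr_gt0.
  rewrite lnM ?posrE// /C5 mulrDl mul1r lerD2r.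
  by rewrite ler_peMr.
have key := @entropy_error_L2 R d T P eps feps a X f K h gam meps ieps deps (i2eps 0)
  Bf Me Mf BK Bs iota CK fepsB ca m0 am0 al0 mX aX dX ifl iK K1 KB Ksupp iota0
  Khoelder K0 dfeps ddfeps fepsM df ddf fM n n0 (h0 n) h1 (gam0 n).
rewrite powR_rate//.
have w0 : 0 <= (gam n / rho) ^+ 2 by exact: sqr_ge0.
apply: (le_trans (lee_wpmul2l _ key)); first by rewrite lee_fin.
rewrite -EFinM lee_fin.
have -> z : (gam n / rho) ^+ 2 * Num.sqrt z = Num.sqrt (((gam n / rho) ^+ 2) ^+ 2 * z).
  by rewrite sqrtrM ?sqr_ge0// sqrtr_sqr ger0_norm.
have EV0 : 0 <= (BK * kap / h n + cov) / n%:R.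
  by apply: divr_ge0 => //; apply: addr_ge0 => //; apply: divr_ge0; [exact: mulr_ge0|exact: ltW].
(* As [h n <= 1], the constant [cov] is at most [cov / h n]. *)
have EVle : (BK * kap / h n + cov) / n%:R <= C4 / (h n * n%:R).
  rewrite invfM mulrA; apply: ler_wpM2r; first by rewrite invr_ge0 ltW.
  by rewrite /C4 mulrDl lerD2l ler_peMr// invf_ge1.
rewrite ler_wsqrtr//.
apply: (@rate_bound _ _ (h n)) => //; first by rewrite addr_ge0.
by rewrite mulr_ge0 ?sqr_ge0.
Unshelve. all: by end_near. Qed.
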